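(* Let $\varepsilon > 0$ be fixed. Then for almost every squarefree integer $d \geq 1$ we have $\eta_d(-1,0) > d^{5/8 - \varepsilon}$; that is, \[ \#\{ d \leq X : d \text{ squarefree},\ \eta_d(-1,0) \leq d^{5/8-\varepsilon}\} = o(X) \quad (X \to \infty). \]
   Context: For a squarefree integer $d \geq 1$, let $E_d$ be the elliptic curve over $\mathbb{Q}$ given by $d y^2 = x^3 - x$ (the congruent number curve twisted by $d$). Let $\hat{h}_{E_d}$ be the canonical (Néron–Tate) height on $E_d(\mathbb{Q})$, normalized so that $\hat{h}_{E_d}(P) = \frac12 h_x(P) + O(1)$, where $h_x(x:y:z)$ is the logarithmic Weil height of $(x:z) \in \mathbb{P}^1(\mathbb{Q})$. Define $\eta_d(-1,0)$ by $\log \eta_d(-1,0) = \min\{\hat{h}_{E_d}(P) : P \in E_d(\mathbb{Q}) \setminus E_d(\mathbb{Q})_{\mathrm{tors}}\}$ if $E_d(\mathbb{Q})$ has positive rank, and $\eta_d(-1,0) = \infty$ if $E_d(\mathbb{Q})$ has rank $0$. *)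

(* Defs.v *)
From HB Require Import structures.
From mathcomp Require Export all_boot all_order all_algebra.
From mathcomp Require Export finmap.
From mathcomp Require Export all_classical all_reals all_analysis.
From mathcomp Require Import ring.

Set Implicit Arguments.
Unset Strict Implicit.
Unset Printing Implicit Defensive.

Export Order.TTheory GRing.Theory Num.Theory.
Export numFieldNormedType.Exports.

Local Open Scope classical_set_scope.
Local Open Scope ring_scope.

Definition squarefree (d : nat) : Prop :=
  forall p : nat, prime p -> ~~ (p ^ 2 %| d)%N.

(* Points of P^2(Q) that can lie on a curve in Weierstrass-like form: the      *)
(* point at infinity (0 : 1 : 0) and the affine points (x : y : 1).            *)
Inductive point := Infinity | Affine of rat & rat.

Definition on_curve (d : nat) (P : point) : Prop :=
  if P is Affine x y then d%:R * y ^+ 2 = x ^+ 3 - x else True.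

(* Chord and tangent law on d y^2 = x^3 - x, with neutral element Infinity. If *)
(* l is the slope of the line through P and Q (the tangent when P = Q), the    *)
(* abscissas of its three intersections with the curve add up to d l^2.        *)
Definition addp (d : nat) (P Q : point) : point :=
  match P, Q with
  | Infinity, _ => Q
  | _, Infinity => P
  | Affine x1 y1, Affine x2 y2 =>
    if (x1 == x2) && (y1 == - y2) then Infinity else
    let l := if x1 == x2 then (3 * x1 ^+ 2 - 1) / (2 * d%:R * y1)
             else (y2 - y1) / (x2 - x1) in
    let x3 := d%:R * l ^+ 2 - x1 - x2 in
    Affine x3 (l * (x1 - x3) - y1)
  end.

Definition mulp (d n : nat) (P : point) : point := iter n (addp d P) Infinity.

Definition torsion (d : nat) (P : point) : Prop :=
  exists2 n : nat, (0 < n)%N & mulp d n P = Infinity.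

Definition nontorsion_points (d : nat) : set point :=
  [set P | on_curve d P /\ ~ torsion d P].

(* Logarithmic Weil height of (x : z) in P^1(Q); Infinity is sent to (1 : 0).  *)
Definition height_x (R : realType) (P : point) : R :=
  if P is Affine x _ then ln (maxn `|numq x|%N `|denq x|%N)%:R else 0.

(* Tate's limit  lim_n 4^-n (1/2) h_x(2^n P), which is the canonical height    *)
(* normalised by  1/2 h_x + O(1).                                              *)
Definition canonical_height (R : realType) (d : nat) (P : point) : R :=
  limn (fun n : nat =>
    4 ^- n * (2^-1 * height_x R (iter n (fun Q => addp d Q Q) P))).

(* The least element of A (0 if there is none). *)
Definition set_min (R : realType) (A : set R) : R := xget 0 (A `&` lbound A).

(* The rank of E_d(Q) is positive iff E_d(Q) has a point of infinite order.    *)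
Definition eta (R : realType) (d : nat) : \bar R :=
  if `[< nontorsion_points d !=set0 >]
  then (expR (set_min (canonical_height R d @` nontorsion_points d)))%:E
  else +oo%E.

Lemma on_curve_addp (d : nat) (P Q : point) : (0 < d)%N ->
  on_curve d P -> on_curve d Q -> on_curve d (addp d P Q).
Proof.
move=> d0; have dN0 : (d%:R : rat) != 0 by rewrite pnatr_eq0 -lt0n.
case: P Q => [|x1 y1] [|x2 y2] //= E1 E2.
have [ex|nx] /= := eqVneq x1 x2.
  subst x2; have [//|ny /=] := eqVneq y1 (- y2).
  have ey : y1 = y2.
    have /eqP : d%:R * y1 ^+ 2 = d%:R * y2 ^+ 2 by rewrite E1 E2.
    rewrite (inj_eq (mulfI dN0)) eqf_sqr (negPf ny) orbF => /eqP //.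
  subst y2.
  have y0 : y1 != 0 by apply: contraNneq ny => ->; rewrite oppr0.
  set l := _ / _; have hl : 2 * d%:R * y1 * l = 3 * x1 ^+ 2 - 1.
    by rewrite /l mulrC divfK // !mulf_neq0.
  apply/eqP; rewrite -subr_eq0; apply/eqP.
  set x3 := d%:R * l ^+ 2 - x1 - x1.
  have -> : d%:R * (l * (x1 - x3) - y1) ^+ 2 - (x3 ^+ 3 - x3)
    = (d%:R * y1 ^+ 2 - (x1 ^+ 3 - x1))
      + (x3 - x1) * (2 * d%:R * y1 * l - (3 * x1 ^+ 2 - 1)).
    by rewrite /x3; ring.
  by rewrite E1 hl !subrr mulr0 addr0.
set l := _ / _; have nx' : x2 - x1 != 0 by rewrite subr_eq0 eq_sym.
have hl : l * (x2 - x1) = y2 - y1 by rewrite /l divfK.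
clearbody l; set x3 := d%:R * l ^+ 2 - x1 - x2.
have ey2 : y2 = y1 + l * (x2 - x1) by rewrite hl; ring.
subst y2; apply: (mulfI nx').
apply/eqP; rewrite -subr_eq0; apply/eqP.
have -> : (x2 - x1) * (d%:R * (l * (x1 - x3) - y1) ^+ 2)
      - (x2 - x1) * (x3 ^+ 3 - x3)
  = (x2 - x3) * (d%:R * y1 ^+ 2 - (x1 ^+ 3 - x1))
  + (x3 - x1) * (d%:R * (y1 + l * (x2 - x1)) ^+ 2 - (x2 ^+ 3 - x2)).
  by rewrite /x3; ring.
by rewrite E1 E2 !subrr !mulr0 addr0.
Qed.

(* Main.v *)
(**
The duplication [x(2P) = (x^2 + 1)^2 / (4 (x^3 - x))] does not involve [d], so
the canonical height is at least [h_x / 2 - ln 16] uniformly in [d].  A small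
[eta_d] therefore yields coprime [a > b > 0] with [a << X^(5/4 - 2 eps)] such
that [d] is the squarefree part of [a b (a - b) (a + b)]; adding a 2-torsion
point makes [a + b] odd, so that the four factors are pairwise coprime and [d]
is the product of their squarefree parts.  Three of these have product at most
[X^(3/4)], and the corresponding factors are linearly dependent: they give a
coprime sum [p + q = r] of numbers [c_i u_i^2] with [c1 c2 c3 << X^(3/4)].

For fixed [c], the points [u] of the conic [c1 u1^2 + c2 u2^2 = c3 u3^2] are
split into at most [tau(c1) tau(c2) tau(c3)] classes, inside which every 3x3
determinant of points is divisible by [C = c1 c2 c3].  Three isotropic vectors
satisfy [C det(u,v,w)^2 = 2 B(u,v) B(v,w) B(u,w)] with [B] the polar form, and
[0 < B < C/2] on arcs of length about [sqrt(C/N)], where [r <= N]; so each class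
has at most two points on each arc, and there are [O(1 + sqrt(N/C))] arcs.
Summing over [c1 c2 c3 <= Y] gives [O((Y + sqrt(N Y)) (log Y)^6)], which is
[o(X)] for [Y = X^(3/4)] and [N = X^(5/4 - 2 eps)].
*)

Require Import Defs.
From mathcomp Require Import ring lra zify.

Set Implicit Arguments.
Unset Strict Implicit.
Unset Printing Implicit Defensive.

Local Open Scope ring_scope.

(** * Squarefree part *)

Definition sqroot_part (n : nat) : nat := \max_(u < n.+1 | (u ^ 2 %| n)%N) u.

Definition sqfree_part (n : nat) : nat := (n %/ sqroot_part n ^ 2)%N.

Section SquarefreePart.
Local Open Scope nat_scope.

Lemma sqroot_part_dvd n : 0 < n -> sqroot_part n ^ 2 %| n.
Proof.
move=> n0; rewrite /sqroot_part.
have h : (fun u : 'I_n.+1 => u ^ 2 %| n) (inord 1) by rewrite /= inordK // dvd1n.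
by rewrite (bigop.bigmax_eq_arg (inord 1)) //; case: arg_maxnP.
Qed.

Lemma sqroot_part_max n u : 0 < n -> u ^ 2 %| n -> u <= sqroot_part n.
Proof.
move=> n0 un.
have un1 : u < n.+1.
  by rewrite ltnS (leq_trans _ (dvdn_leq n0 un)) // expnS expn1; case: u {un} => // u; rewrite leq_pmulr.
exact: (@bigop.leq_bigmax_cond _ (fun u : 'I_n.+1 => u ^ 2 %| n) (fun u => u : nat) (Ordinal un1)).
Qed.

Lemma sqroot_part_gt0 n : 0 < n -> 0 < sqroot_part n.
Proof. by move=> n0; apply: sqroot_part_max; rewrite ?dvd1n. Qed.

Lemma sqfree_partE n : 0 < n -> n = sqfree_part n * sqroot_part n ^ 2.
Proof. by move=> n0; rewrite divnK ?sqroot_part_dvd. Qed.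

Lemma sqfree_part_gt0 n : 0 < n -> 0 < sqfree_part n.
Proof. by move=> n0; move: (n0); rewrite {1}(sqfree_partE n0) muln_gt0 => /andP[]. Qed.

Lemma sqfree_part_le w u : 0 < w * u ^ 2 -> sqfree_part (w * u ^ 2) <= w.
Proof.
move=> n0; have := sqroot_part_max n0 (dvdn_mull w (dvdnn _)).
move: (n0); rewrite muln_gt0 => /andP[w0 u0] ur.
rewrite -(leq_pmul2r u0) {2}(sqfree_partE n0).
by rewrite leq_mul // leq_exp2r.
Qed.

Lemma squarefree_sqfree_part n : 0 < n -> squarefree (sqfree_part n).
Proof.
move=> n0 p pp; apply/negP => pd.
have : (p * sqroot_part n) ^ 2 %| n.
  by rewrite {2}(sqfree_partE n0) expnMn dvdn_mul.
move/(sqroot_part_max n0); rewrite leqNgt => /negP; apply.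
by rewrite ltn_Pmull ?prime_gt1 ?sqroot_part_gt0.
Qed.

Lemma squarefree_sqr_dvd d k : squarefree d -> k ^ 2 %| d -> k = 1.
Proof.
move=> sd kd; apply/eqP/contraT => k1.
case: (posnP k) => [k0|k0].
  have /negP := sd 2 isT; case; apply: dvdn_trans kd.
  by rewrite k0 dvdn0.
have kgt1 : 1 < k by lia.
have /negP := sd _ (pdiv_prime kgt1); case.
by apply: dvdn_trans kd; rewrite dvdn_exp2r // pdiv_dvd.
Qed.

(** After division of [m] and [m'] by their gcd, the coprime squares [k ^ 2] and [k' ^ 2] divide
    [d'] and [d] respectively, so both are 1. *)
Lemma squarefree_mul_sqr_inj d d' m m' : squarefree d -> squarefree d' ->
  0 < m -> 0 < m' -> d * m ^ 2 = d' * m' ^ 2 -> d = d'.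
Proof.
move=> sd sd' m0 m'0 e; have g0 : 0 < gcdn m m' by rewrite gcdn_gt0 m0.
have cop : coprime (m %/ gcdn m m') (m' %/ gcdn m m').
  rewrite /coprime -(eqn_pmul2r g0) muln_gcdl mul1n.
  by rewrite !divnK ?dvdn_gcdl ?dvdn_gcdr.
have e2 : d * (m %/ gcdn m m') ^ 2 = d' * (m' %/ gcdn m m') ^ 2.
  apply/eqP; rewrite -(eqn_pmul2r (_ : 0 < gcdn m m' ^ 2)) ?expn_gt0 ?g0 //.
  rewrite -[X in X == _]mulnA -[X in _ == X]mulnA -!expnMn.
  by rewrite !divnK ?dvdn_gcdl ?dvdn_gcdr // e.
move: cop e2; set k := _ %/ _; set k' := _ %/ _ => cop e2.
have k1 : k = 1.
  apply: (squarefree_sqr_dvd sd').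
  rewrite -(@Gauss_dvdl _ _ (k' ^ 2)) ?coprimeXl ?coprimeXr //.
  by rewrite -e2 dvdn_mull.
have k'1 : k' = 1.
  apply: (squarefree_sqr_dvd sd).
  rewrite -(@Gauss_dvdl _ _ (k ^ 2)) ?coprimeXl ?coprimeXr 1?coprime_sym //.
  by rewrite e2 dvdn_mull.
by move: e2; rewrite k1 k'1 !muln1.
Qed.

(** Uniqueness of the squarefree representative modulo nonzero squares; this is how [d] is recovered
    from a point on its curve. *)
Lemma sqfree_part_eq d m n k : squarefree d -> 0 < m -> 0 < n -> 0 < k ->
  d * m ^ 2 = n * k ^ 2 -> sqfree_part n = d.
Proof.
move=> sd m0 n0 k0; rewrite {1}(sqfree_partE n0) -mulnA -expnMn => e.
apply/esym; apply: (squarefree_mul_sqr_inj sd (squarefree_sqfree_part n0) m0 _ e).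
by rewrite muln_gt0 sqroot_part_gt0.
Qed.

Lemma squarefreeM m n : coprime m n -> squarefree m -> squarefree n ->
  squarefree (m * n).
Proof.
move=> cmn sm sn p pp; apply/negP => pmn.
have [pm|pm] := boolP (p %| m).
  have pn : coprime p n by exact: coprime_dvdl cmn.
  by move: pmn; rewrite Gauss_dvdl ?coprimeXl //; apply/negP/sm.
move: pmn; rewrite Gauss_dvdr ?coprimeXl ?prime_coprime //; apply/negP/sn => //.
Qed.

Lemma sqfree_partM m n : 0 < m -> 0 < n -> coprime m n ->
  sqfree_part (m * n) = sqfree_part m * sqfree_part n.
Proof.
move=> m0 n0 cmn.
apply: (@sqfree_part_eq _ (sqroot_part m * sqroot_part n) _ 1) => //.
- apply: squarefreeM; try exact: squarefree_sqfree_part.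
  move: cmn; rewrite {1}(sqfree_partE m0) {1}(sqfree_partE n0).
  by rewrite coprimeMl !coprimeMr => /andP[/andP[]].
- by rewrite muln_gt0 !sqroot_part_gt0.
- by rewrite muln_gt0 m0.
rewrite exp1n muln1 {3}(sqfree_partE m0) {3}(sqfree_partE n0).
by rewrite expnMn mulnACA.
Qed.

End SquarefreePart.

(** * Points on a diagonal conic *)

(** Each prime divisor of a squarefree [c] occurs to the first power, so divisibility by [c] can be
    tested prime by prime. *)
Lemma squarefree_dvdz (c : nat) (x : int) : squarefree c ->
  (forall p, prime p -> (p %| c)%N -> (p%:Z %| x)%Z) -> (c%:Z %| x)%Z.
Proof.
move=> sc h; have [->|x0] := eqVneq x 0; first exact: dvdz0.
have c0 : (0 < c)%N.
  by case: (posnP c) sc => // ->; move=> /(_ 2 isT); rewrite dvdn0.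
rewrite dvdzE; apply/dvdn_partP => // p.
rewrite mem_primes => /and3P[pp _ pc].
have -> : (c`_p = p)%N.
  rewrite p_part; suff -> : logn p c = 1%N by rewrite expn1.
  apply/eqP; rewrite eqn_leq -pfactor_dvdn // expn1 pc andbT leqNgt.
  by rewrite -pfactor_dvdn //; exact: sc.
by have := h p pp pc; rewrite dvdzE.
Qed.

(* The class of a solution of [al x^2 + be y^2 = 0 (mod c)] is recorded, relatively
   to a reference solution [z], by [gcd(c, u1 z2 - u2 z1)]: modulo each prime
   divisor of [c] the ratio [u1 / u2] is [z1 / z2] or [- z1 / z2]. *)
Lemma minor_dvdz (c : nat) (al be u1 u2 v1 v2 z1 z2 : int) :
  squarefree c -> coprimez c%:Z al -> coprimez c%:Z z2 ->
  (c%:Z %| al * u1 ^+ 2 + be * u2 ^+ 2)%Z ->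
  (c%:Z %| al * v1 ^+ 2 + be * v2 ^+ 2)%Z ->
  (c%:Z %| al * z1 ^+ 2 + be * z2 ^+ 2)%Z ->
  gcdn c (absz (u1 * z2 - u2 * z1)%R) = gcdn c (absz (v1 * z2 - v2 * z1)%R) ->
  (c%:Z %| u1 * v2 - u2 * v1)%Z.
Proof.
move=> sc cal cz cu cv czz eg; apply: squarefree_dvdz => // p pp pc.
have pcz : (p%:Z %| c%:Z)%Z by rewrite dvdzE.
have pal : coprimez p%:Z al by apply: coprimez_dvdl cal.
have pz : coprimez p%:Z z2 by apply: coprimez_dvdl cz.
have Eucl (x y : int) : (p%:Z %| x * y)%Z -> (p%:Z %| x)%Z || (p%:Z %| y)%Z.
  by rewrite !dvdzE abszM Euclid_dvdM.
have pm w1 w2 : (c%:Z %| al * w1 ^+ 2 + be * w2 ^+ 2)%Z ->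
    (p%:Z %| w1 * z2 - w2 * z1)%Z || (p%:Z %| w1 * z2 + w2 * z1)%Z.
  move=> cw; apply: Eucl; rewrite -(Gauss_dvdzr _ pal).
  (* Eliminating [be] between the congruences for [w] and [z] leaves [al] times a difference of
     squares, one factor of which [p] must divide. *)
  have -> : al * ((w1 * z2 - w2 * z1) * (w1 * z2 + w2 * z1)) =
      z2 ^+ 2 * (al * w1 ^+ 2 + be * w2 ^+ 2)
      - w2 ^+ 2 * (al * z1 ^+ 2 + be * z2 ^+ 2) by ring.
  by rewrite rpredB // dvdz_mull // (dvdz_trans pcz).
(* Equal gcds have the same prime divisors, so [u] and [v] carry the same sign relative to [z] at
   [p]. *)
have key : (p%:Z %| u1 * z2 - u2 * z1)%Z = (p%:Z %| v1 * z2 - v2 * z1)%Z.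
  have := congr1 (dvdn p) eg; rewrite !dvdn_gcd pc /= => e.
  by rewrite !dvdzE.
rewrite -(Gauss_dvdzr _ pz).
have [hu|hu] := boolP (p%:Z %| u1 * z2 - u2 * z1)%Z.
  have -> : z2 * (u1 * v2 - u2 * v1) =
    v2 * (u1 * z2 - u2 * z1) - u2 * (v1 * z2 - v2 * z1) by ring.
  by rewrite rpredB // dvdz_mull // -key.
have hu' : (p%:Z %| u1 * z2 + u2 * z1)%Z by have := pm _ _ cu; rewrite (negPf hu).
have hv' : (p%:Z %| v1 * z2 + v2 * z1)%Z.
  by have := pm _ _ cv; rewrite -key (negPf hu).
have -> : z2 * (u1 * v2 - u2 * v1) =
  v2 * (u1 * z2 + u2 * z1) - u2 * (v1 * z2 + v2 * z1) by ring.
by rewrite rpredB // dvdz_mull.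
Qed.

Section Conic.
Variable K : comPzRingType.
Implicit Types c u v w : K * K * K.

Definition conic c u : Prop :=
  c.1.1 * u.1.1 ^+ 2 + c.1.2 * u.1.2 ^+ 2 = c.2 * u.2 ^+ 2.

(** Normalised without a factor 2: [polar c u u] is the quadratic form itself, and points of the
    conic are its isotropic vectors. *)
Definition polar c u v : K :=
  c.2 * u.2 * v.2 - c.1.1 * u.1.1 * v.1.1 - c.1.2 * u.1.2 * v.1.2.

Definition det3 u v w : K :=
  u.1.1 * (v.1.2 * w.2 - w.1.2 * v.2) - u.1.2 * (v.1.1 * w.2 - w.1.1 * v.2)
  + u.2 * (v.1.1 * w.1.2 - w.1.1 * v.1.2).

(* The right-hand side is the Gram determinant of three isotropic vectors. *)
Lemma conic_det3 c u v w : conic c u -> conic c v -> conic c w ->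
  c.1.1 * c.1.2 * c.2 * det3 u v w ^+ 2
  = 2 * (polar c u v * polar c v w * polar c u w).
Proof.
case: c => [[c1 c2] c3]; case: u => [[u1 u2] u3].
case: v => [[v1 v2] v3]; case: w => [[w1 w2] w3].
rewrite /conic /polar /det3 /= => eu ev ew.
pose qu := c3 * u3 ^+ 2 - (c1 * u1 ^+ 2 + c2 * u2 ^+ 2).
pose qv := c3 * v3 ^+ 2 - (c1 * v1 ^+ 2 + c2 * v2 ^+ 2).
pose qw := c3 * w3 ^+ 2 - (c1 * w1 ^+ 2 + c2 * w2 ^+ 2).
have qu0 : qu = 0 by rewrite /qu eu subrr.
have qv0 : qv = 0 by rewrite /qv ev subrr.
have qw0 : qw = 0 by rewrite /qw ew subrr.
set b12 := c3 * u3 * v3 - _ - _; set b23 := c3 * v3 * w3 - _ - _.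
set b13 := c3 * u3 * w3 - _ - _.
(* Full expansion of the Gram determinant, with diagonal entries [qu], [qv], [qw]; these vanish by
   isotropy. *)
transitivity (2 * (b12 * b23 * b13) + qu * qv * qw
   - qu * b23 ^+ 2 - qv * b13 ^+ 2 - qw * b12 ^+ 2).
  rewrite /b12 /b23 /b13 /qu /qv /qw; ring.
by rewrite qu0 qv0 qw0 !mul0r addr0 !subr0.
Qed.

End Conic.

(** Expanding along the i-th coordinate involves only the 2x2 minors in the other two, which are
    divisible by the i-th coefficient; coprimality combines the three divisors. *)
Lemma dvdz_det3 (c1 c2 c3 : nat) (u v w : int * int * int) :
  coprime c1 c2 -> coprime c1 c3 -> coprime c2 c3 ->
  (forall x y, (x = u \/ x = v \/ x = w) -> (y = u \/ y = v \/ y = w) ->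
    [/\ (c1%:Z %| x.1.2 * y.2 - x.2 * y.1.2)%Z,
        (c2%:Z %| x.1.1 * y.2 - x.2 * y.1.1)%Z &
        (c3%:Z %| x.1.1 * y.1.2 - x.1.2 * y.1.1)%Z]) ->
  ((c1 * c2 * c3)%:Z %| det3 u v w)%Z.
Proof.
move=> h12 h13 h23 h.
have [a1 a2 a3] := h v w ltac:(auto) ltac:(auto).
have [b1 b2 b3] := h u w ltac:(auto) ltac:(auto).
have [d1 d2 d3] := h u v ltac:(auto) ltac:(auto).
have e1 : (c1%:Z %| det3 u v w)%Z.
  have -> : det3 u v w = u.1.1 * (v.1.2 * w.2 - v.2 * w.1.2)
    - v.1.1 * (u.1.2 * w.2 - u.2 * w.1.2) + w.1.1 * (u.1.2 * v.2 - u.2 * v.1.2).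
    by rewrite /det3; ring.
  by rewrite rpredD ?rpredB // dvdz_mull.
have e2 : (c2%:Z %| det3 u v w)%Z.
  have -> : det3 u v w = - (u.1.2 * (v.1.1 * w.2 - v.2 * w.1.1)
    - v.1.2 * (u.1.1 * w.2 - u.2 * w.1.1) + w.1.2 * (u.1.1 * v.2 - u.2 * v.1.1)).
    by rewrite /det3; ring.
  by rewrite rpredN rpredD ?rpredB // dvdz_mull.
have e3 : (c3%:Z %| det3 u v w)%Z.
  have -> : det3 u v w = u.2 * (v.1.1 * w.1.2 - v.1.2 * w.1.1)
    - v.2 * (u.1.1 * w.1.2 - u.1.2 * w.1.1) + w.2 * (u.1.1 * v.1.2 - u.1.2 * v.1.1).
    by rewrite /det3; ring.
  by rewrite rpredD ?rpredB // dvdz_mull.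
rewrite !PoszM Gauss_dvdz; last by rewrite -PoszM coprimezE coprimeMl h13.
by rewrite e3 andbT Gauss_dvdz // e1 e2.
Qed.

(** * Size of the polar form on a short arc *)

Section ConicReal.
Variable R : realType.

(** The middle term is half the squared chord. Since [y^2 - y'^2 = x'^2 - x^2] and
    [x + x' <= y + y'], the ordinates differ by no more than the abscissas. *)
Lemma circle_chord (x y x' y' : R) : 0 <= x <= y -> 0 <= x' <= y' ->
  x ^+ 2 + y ^+ 2 = 1 -> x' ^+ 2 + y' ^+ 2 = 1 ->
  0 <= 1 - x * x' - y * y' <= (x - x') ^+ 2.
Proof.
move=> /andP[x0 xy] /andP[x'0 xy'] e e'.
have y0 : 0 < y by nra.
have h : (y - y') ^+ 2 <= (x - x') ^+ 2.
  rewrite -(ler_pM2r (_ : 0 < (y + y') ^+ 2)); last by rewrite exprn_gt0 //; lra.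
  have -> : (y - y') ^+ 2 * (y + y') ^+ 2 = (x - x') ^+ 2 * (x + x') ^+ 2.
    have : y ^+ 2 - y' ^+ 2 = x' ^+ 2 - x ^+ 2 by lra.
    rewrite !subr_sqr -!exprMn => ->; ring.
  by rewrite ler_wpM2l ?sqr_ge0 // lerXn2r ?nnegrE //; lra.
have : 2 * (1 - x * x' - y * y') = (x - x') ^+ 2 + (y - y') ^+ 2.
  transitivity ((x ^+ 2 + y ^+ 2) + (x' ^+ 2 + y' ^+ 2) - 2 * x * x' - 2 * y * y').
    by rewrite e e'; ring.
  by ring.
have := sqr_ge0 (x - x'); have := sqr_ge0 (y - y'); lra.
Qed.

(** For nonnegative coordinates, the abscissa of [u] once the conic is rescaled to the unit
    circle. *)
Definition slope (c u : R * R * R) : R :=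
  Num.sqrt (c.1.1 * u.1.1 ^+ 2 / (c.2 * u.2 ^+ 2)).

(** On the unit circle [polar c u v] becomes [c3 u3 v3] times half a squared chord, and [c3 u3 v3]
    is the geometric mean of [c3 u3^2] and [c3 v3^2], hence at most [N]. *)
Lemma polar_le (N : R) (c u v : R * R * R) :
  0 < c.1.1 -> 0 < c.1.2 -> 0 < c.2 ->
  0 <= u.1.1 -> 0 <= u.1.2 -> 0 < u.2 -> 0 <= v.1.1 -> 0 <= v.1.2 -> 0 < v.2 ->
  conic c u -> conic c v ->
  c.1.1 * u.1.1 ^+ 2 <= c.1.2 * u.1.2 ^+ 2 ->
  c.1.1 * v.1.1 ^+ 2 <= c.1.2 * v.1.2 ^+ 2 ->
  c.2 * u.2 ^+ 2 <= N -> c.2 * v.2 ^+ 2 <= N ->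
  0 <= polar c u v <= N * (slope c u - slope c v) ^+ 2.
Proof.
case: c => [[c1 c2] c3]; case: u => [[u1 u2] u3]; case: v => [[v1 v2] v3].
rewrite /conic /polar /slope /= => c1p c2p c3p u1p u2p u3p v1p v2p v3p eu ev ou ov uN vN.
pose k := Num.sqrt (c1 / c3); pose l := Num.sqrt (c2 / c3).
have k0 : 0 <= k by apply: sqrtr_ge0.
have l0 : 0 <= l by apply: sqrtr_ge0.
have ek : k ^+ 2 * c3 = c1 by rewrite sqr_sqrtr ?divfK ?gt_eqF // divr_ge0 // ltW.
have el : l ^+ 2 * c3 = c2 by rewrite sqr_sqrtr ?divfK ?gt_eqF // divr_ge0 // ltW.
have slopeE x y : 0 <= x -> 0 < y -> Num.sqrt (c1 * x ^+ 2 / (c3 * y ^+ 2)) = k * x / y.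
  move=> x0 y0; have -> : c1 * x ^+ 2 / (c3 * y ^+ 2) = (k * x / y) ^+ 2.
    by rewrite -ek; field; rewrite !gt_eqF.
  by rewrite sqrtr_sqr ger0_norm // divr_ge0 ?mulr_ge0 // ltW.
rewrite !slopeE //.
have coord x1 x2 x3 : 0 <= x1 -> 0 <= x2 -> 0 < x3 ->
    c1 * x1 ^+ 2 + c2 * x2 ^+ 2 = c3 * x3 ^+ 2 -> c1 * x1 ^+ 2 <= c2 * x2 ^+ 2 ->
    (0 <= k * x1 / x3 <= l * x2 / x3) /\ (k * x1 / x3) ^+ 2 + (l * x2 / x3) ^+ 2 = 1.
  move=> x1p x2p x3p ex ox; split.
    rewrite divr_ge0 ?mulr_ge0 ?(ltW x3p) //= ler_pM2r ?invr_gt0 //.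
    rewrite -(@ler_pXn2r _ 2) ?nnegrE ?mulr_ge0 //.
    rewrite -(ler_pM2r c3p).
    have -> : (k * x1) ^+ 2 * c3 = k ^+ 2 * c3 * x1 ^+ 2 by ring.
    have -> : (l * x2) ^+ 2 * c3 = l ^+ 2 * c3 * x2 ^+ 2 by ring.
    by rewrite ek el.
  have : (k ^+ 2 * c3) * x1 ^+ 2 + (l ^+ 2 * c3) * x2 ^+ 2 = c3 * x3 ^+ 2 by rewrite ek el.
  move=> e; apply: (mulfI (_ : c3 * x3 ^+ 2 != 0)).
    by rewrite mulf_neq0 ?expf_neq0 // gt_eqF.
  by rewrite mulr1 -[RHS]e; field; rewrite gt_eqF.
have [ru su] := coord _ _ _ u1p u2p u3p eu ou.
have [rv sv] := coord _ _ _ v1p v2p v3p ev ov.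
have /andP[h0 h1] := circle_chord ru rv su sv.
have -> : c3 * u3 * v3 - c1 * u1 * v1 - c2 * u2 * v2 =
   (c3 * u3 * v3) * (1 - (k * u1 / u3) * (k * v1 / v3) - (l * u2 / u3) * (l * v2 / v3)).
  by rewrite -ek -el; field; rewrite !gt_eqF.
have m0 : 0 <= c3 * u3 * v3 by rewrite !mulr_ge0 // ltW.
apply/andP; split; first exact: mulr_ge0.
apply: ler_pM => //.
nra.
Qed.

End ConicReal.

(** * Coprime sums as points on conics, and their classes *)

Definition ptriple (S T : Type) (f : S -> T) (x : S * S * S) : T * T * T :=
  (f x.1.1, f x.1.2, f x.2).

Definition sqfree_parts (p q : nat) : nat * nat * nat :=
  ptriple sqfree_part (p, q, (p + q)%N).

Definition sqroot_parts (p q : nat) : int * int * int :=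
  ptriple (fun n => (sqroot_part n)%:Z) (p, q, (p + q)%N).

Definition tprod (c : nat * nat * nat) : nat := (c.1.1 * c.1.2 * c.2)%N.

(** The order [p <= q] places the point on the arc where [circle_chord] applies; coprimality makes
    the three squarefree parts pairwise coprime. *)
Definition admissible (n p q : nat) : bool :=
  [&& 0 < p, p <= q, coprime p q & p + q <= n]%N.

(** One divisor of each coefficient, recording the signs relative to [z] at its primes; this is the
    source of the factor [tau(c1) tau(c2) tau(c3)]. *)
Definition minor_classes (c : nat * nat * nat) (z u : int * int * int) :
    nat * nat * nat :=
  (gcdn c.1.1 `|(u.1.2 * z.2 - u.2 * z.1.2)%R|,
   gcdn c.1.2 `|(u.1.1 * z.2 - u.2 * z.1.1)%R|,
   gcdn c.2 `|(u.1.1 * z.1.2 - u.1.2 * z.1.1)%R|)%N.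

Section Admissible.
Variables (n p q : nat).
Hypothesis apq : admissible n p q.
Let c := sqfree_parts p q.
Let u := sqroot_parts p q.

Let p0 : (0 < p)%N. Proof. by case/and4P: apq. Qed.
Let q0 : (0 < q)%N. Proof. by case/and4P: apq; lia. Qed.
Let r0 : (0 < p + q)%N. Proof. by rewrite addn_gt0 p0. Qed.

Lemma sqfree_parts_gt0 : [/\ 0 < c.1.1, 0 < c.1.2 & 0 < c.2]%N.
Proof. by rewrite !sqfree_part_gt0. Qed.

Lemma sqroot_parts_gt0 : [/\ 0 < u.1.1, 0 < u.1.2 & 0 < u.2].
Proof. by rewrite !ltz_nat !sqroot_part_gt0. Qed.

Lemma squarefree_parts : [/\ squarefree c.1.1, squarefree c.1.2 & squarefree c.2].
Proof. by split; apply: squarefree_sqfree_part. Qed.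

Lemma sqfree_partsE : [/\ c.1.1%:Z * u.1.1 ^+ 2 = p%:Z,
  c.1.2%:Z * u.1.2 ^+ 2 = q%:Z & c.2%:Z * u.2 ^+ 2 = (p + q)%:Z].
Proof.
have E m : (0 < m)%N -> (sqfree_part m)%:Z * (sqroot_part m)%:Z ^+ 2 = m%:Z.
  by move=> m0; rewrite {3}(sqfree_partE m0) PoszM -mulnn PoszM.
by split; apply: E.
Qed.

Lemma conic_parts : conic (ptriple Posz c) u.
Proof. by rewrite /conic; have [/= -> -> ->] := sqfree_partsE; rewrite PoszD. Qed.

(** The three [coprimez] clauses are what [minor_dvdz] requires of its reference solution for each
    of the three moduli. *)
Lemma coprime_parts : [/\ coprime c.1.1 c.1.2, coprime c.1.1 c.2, coprime c.1.2 c.2,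
  coprimez c.1.1%:Z u.2 & coprimez c.1.2%:Z u.2] /\ coprimez c.2%:Z u.1.2.
Proof.
have cpq : coprime p q by case/and4P: apq.
have cpr : coprime p (p + q) by rewrite /coprime gcdnDl.
have cqr : coprime q (p + q) by rewrite /coprime gcdnDr gcdnC.
have d1 m : (0 < m)%N -> (sqfree_part m %| m)%N.
  by move=> m0; rewrite {2}(sqfree_partE m0) dvdn_mulr.
have d2 m : (0 < m)%N -> (sqroot_part m %| m)%N.
  by move=> m0; rewrite {2}(sqfree_partE m0) expnS mulnCA dvdn_mulr.
have cop a b a' b' : coprime a b -> (a' %| a)%N -> (b' %| b)%N -> coprime a' b'.
  by move=> h ha hb; apply: (coprime_dvdl ha); apply: (coprime_dvdr hb).
rewrite !coprimezE /=; split; first split.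
- by apply: cop cpq _ _; apply: d1.
- by apply: cop cpr _ _; apply: d1.
- by apply: cop cqr _ _; apply: d1.
- by apply: cop cpr _ _; [apply: d1|apply: d2].
- by apply: cop cqr _ _; [apply: d1|apply: d2].
- by rewrite coprime_sym; apply: cop cqr _ _; [apply: d2|apply: d1].
Qed.

End Admissible.

(** Modulo each coefficient the conic equation loses one variable and becomes a binary quadratic
    congruence, to which [minor_dvdz] applies. *)
Lemma minors_dvdz n p q p' q' pz qz (c := sqfree_parts p q)
    (u := sqroot_parts p q) (v := sqroot_parts p' q') (z := sqroot_parts pz qz) :
  admissible n p q -> admissible n p' q' -> admissible n pz qz ->
  sqfree_parts p' q' = c -> sqfree_parts pz qz = c ->
  minor_classes c z u = minor_classes c z v ->
  [/\ (c.1.1%:Z %| u.1.2 * v.2 - u.2 * v.1.2)%Z,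
      (c.1.2%:Z %| u.1.1 * v.2 - u.2 * v.1.1)%Z &
      (c.2%:Z %| u.1.1 * v.1.2 - u.1.2 * v.1.1)%Z].
Proof.
move=> au av az ev ez.
have [s1 s2 s3] := squarefree_parts au.
have [[c12 c13 c23 _ _] _] := coprime_parts au.
have [[_ _ _ cz1 cz2] cz3] := coprime_parts az.
rewrite ez -/z in cz1 cz2 cz3.
have cu := conic_parts au; have := conic_parts av; have := conic_parts az.
rewrite ev ez -/z -/v => cz cv.
rewrite -/c -/u in cu s1 s2 s3 c12 c13 c23 ev.
clearbody c u v z.
move: cu cv cz; rewrite /conic /= => cu cv cz e.
have e1 := congr1 (fun t => t.1.1) e; have e2 := congr1 (fun t => t.1.2) e.
have e3 := congr1 snd e; rewrite /minor_classes /= in e1 e2 e3.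
have z12 : coprimez c.1.1 c.1.2 by rewrite coprimezE.
have z21 : coprimez c.1.2 c.1.1 by rewrite coprimezE coprime_sym.
have z31 : coprimez c.2 c.1.1 by rewrite coprimezE coprime_sym.
split.
- apply: (@minor_dvdz _ c.1.2 (- c.2%:Z) u.1.2 u.2 v.1.2 v.2 z.1.2 z.2 s1 z12 cz1 _ _ _ e1).
  + by rewrite mulNr -cu opprD addrCA subrr addr0 rpredN dvdz_mulr.
  + by rewrite mulNr -cv opprD addrCA subrr addr0 rpredN dvdz_mulr.
  + by rewrite mulNr -cz opprD addrCA subrr addr0 rpredN dvdz_mulr.
- apply: (@minor_dvdz _ c.1.1 (- c.2%:Z) u.1.1 u.2 v.1.1 v.2 z.1.1 z.2 s2 z21 cz2 _ _ _ e2).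
  + by rewrite mulNr -cu opprD addrA subrr add0r rpredN dvdz_mulr.
  + by rewrite mulNr -cv opprD addrA subrr add0r rpredN dvdz_mulr.
  + by rewrite mulNr -cz opprD addrA subrr add0r rpredN dvdz_mulr.
- apply: (@minor_dvdz _ c.1.1 c.1.2 u.1.1 u.1.2 v.1.1 v.1.2 z.1.1 z.1.2 s3 z31 cz3 _ _ _ e3).
  + by rewrite cu dvdz_mulr.
  + by rewrite cv dvdz_mulr.
  + by rewrite cz dvdz_mulr.
Qed.

(** * At most two points of a class on each arc *)

Section ThreePoints.
Variable R : realType.

(** Index of the arc containing the point: the abscissa is cut into intervals of length
    [sqrt (C / (2 n))], which forces [polar < C / 2] inside one arc. *)
Definition cell (n C p q : nat) : nat :=
  Num.truncn (Num.sqrt (p%:R / (p + q)%:R) * Num.sqrt (2 * n%:R / C%:R) : R).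

Lemma truncn_eq_dist (x y : R) : 0 <= x -> 0 <= y ->
  Num.truncn x = Num.truncn y -> (x - y) ^+ 2 < 1.
Proof.
move=> x0 y0 e; have /andP[a b] := truncn_itv x0; have /andP[a' b'] := truncn_itv y0.
rewrite e in a b; set k := Num.truncn y in a b a' b'; rewrite -natr1 in b b'.
nra.
Qed.

Let toR (x : int) : R := x%:~R.

Lemma polar_toR c u v :
  polar (ptriple toR c) (ptriple toR u) (ptriple toR v) = toR (polar c u v).
Proof. by rewrite /polar /ptriple /= /toR !rmorphB /= !rmorphM. Qed.

Lemma conic_toR c u : conic c u -> conic (ptriple toR c) (ptriple toR u).
Proof.
rewrite /conic /ptriple /= /toR => e.
by rewrite -!rmorphXn -!rmorphM -rmorphD /= e.
Qed.

(** The upper bound is [polar_le] within one cell. If the form vanished, the two isotropic vectors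
    would satisfy [p q' = p' q], and coprime pairs with equal ratio coincide. *)
Lemma polar_gt0_lt n p q p' q' (c := sqfree_parts p q)
    (u := sqroot_parts p q) (v := sqroot_parts p' q') :
  admissible n p q -> admissible n p' q' -> sqfree_parts p' q' = c ->
  cell n (tprod c) p q = cell n (tprod c) p' q' -> (p, q) <> (p', q') ->
  0 < toR (polar (ptriple Posz c) u v) < (tprod c)%:R / 2.
Proof.
move=> au av ec ecell nuv.
have [c1 c2 c3] := sqfree_parts_gt0 au; rewrite -/c in c1 c2 c3.
have [u1 u2 u3] := sqroot_parts_gt0 au; rewrite -/u in u1 u2 u3.
have [v1 v2 v3] := sqroot_parts_gt0 av; rewrite -/v in v1 v2 v3.
have [pu1 pu2 pu3] := sqfree_partsE au; rewrite -/c -/u in pu1 pu2 pu3.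
have [pv1 pv2 pv3] := sqfree_partsE av; rewrite ec -/v in pv1 pv2 pv3.
have cu := conic_parts au; rewrite -/c -/u in cu.
have cv := conic_parts av; rewrite ec -/v in cv.
clearbody c u v; have /and4P[p0 pq cpq rn] := au; have /and4P[p0' pq' cpq' rn'] := av.
have C0 : (0 < tprod c)%N by rewrite /tprod !muln_gt0 c1 c2 c3.
have n0 : (0 < n)%N by lia.
have castE (d : nat) x (m : nat) : d%:Z * x ^+ 2 = m%:Z ->
    toR d * toR x ^+ 2 = m%:R.
  by move=> e; rewrite /toR -rmorphXn -rmorphM /= e.
have tgt0 x : 0 < x -> 0 < toR x by rewrite /toR ltr0z.
have sle u' p1 q1 : toR c.1.1 * toR u'.1.1 ^+ 2 = p1%:R ->
   toR c.2 * toR u'.2 ^+ 2 = (p1 + q1)%N%:R ->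
   slope (ptriple toR (ptriple Posz c)) (ptriple toR u') = Num.sqrt (p1%:R / (p1 + q1)%N%:R).
  by move=> e1 e2; rewrite /slope /= e1 e2.
have := @polar_le R n%:R (ptriple toR (ptriple Posz c)) (ptriple toR u) (ptriple toR v).
rewrite polar_toR (sle u p q (castE _ _ _ pu1) (castE _ _ _ pu3)).
rewrite (sle v p' q' (castE _ _ _ pv1) (castE _ _ _ pv3)) /=.
have := conic_toR cu; have := conic_toR cv => hv hu.
rewrite (castE _ _ _ pu1) (castE _ _ _ pv1) (castE _ _ _ pu2) (castE _ _ _ pv2).
rewrite (castE _ _ _ pu3) (castE _ _ _ pv3) !ler_nat.
move=> /(_ (tgt0 c.1.1 c1) (tgt0 c.1.2 c2) (tgt0 c.2 c3) (ltW (tgt0 _ u1)) (ltW (tgt0 _ u2)) (tgt0 _ u3)).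
move=> /(_ (ltW (tgt0 _ v1)) (ltW (tgt0 _ v2)) (tgt0 _ v3) hu hv pq pq' rn rn').
set B := toR _; set X := Num.sqrt _; set X' := Num.sqrt _ => /andP[B0 Ble].
apply/andP; split.
  rewrite lt_neqAle B0 andbT eq_sym; apply/negP => /eqP; rewrite /B /toR => /eqP.
  rewrite intr_eq0 => /eqP B00; apply: nuv.
  (* Weighted Lagrange identity: with zero polar form, both terms on the right equal
     [(d3 u3 v3)^2]. *)
  have e0 : c.1.1%:Z * c.1.2%:Z * (u.1.1 * v.1.2 - u.1.2 * v.1.1) ^+ 2 = 0.
    move: B00 cu cv; rewrite /polar /conic /=.
    move: (c.1.1%:Z) (c.1.2%:Z) (c.2%:Z) => d1 d2 d3 e eu ev.
    have -> : d1 * d2 * (u.1.1 * v.1.2 - u.1.2 * v.1.1) ^+ 2 =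
      (d1 * u.1.1 ^+ 2 + d2 * u.1.2 ^+ 2) * (d1 * v.1.1 ^+ 2 + d2 * v.1.2 ^+ 2)
      - (d1 * u.1.1 * v.1.1 + d2 * u.1.2 * v.1.2) ^+ 2 by ring.
    rewrite eu ev; have -> : d1 * u.1.1 * v.1.1 + d2 * u.1.2 * v.1.2 = d3 * u.2 * v.2.
      by apply/eqP; rewrite eq_sym -subr_eq0 opprD addrA e.
    by ring.
  have em : u.1.1 * v.1.2 = u.1.2 * v.1.1.
    have d0 : c.1.1%:Z * c.1.2%:Z != 0.
      by rewrite mulf_neq0 // gt_eqF // ltz_nat.
    move: e0 => /eqP; rewrite mulf_eq0 (negPf d0) expf_eq0 /= subr_eq0.
    by move=> /eqP.
  have epq : (p * q' = p' * q)%N.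
    apply/eqP; rewrite -(eqr_nat int) !natz !PoszM -pu1 -pu2 -pv1 -pv2.
    apply/eqP; transitivity (c.1.1%:Z * c.1.2%:Z * (u.1.1 * v.1.2) ^+ 2); first by ring.
    by rewrite em; ring.
  have dpp' : (p %| p')%N by rewrite -(Gauss_dvdl _ cpq) -epq dvdn_mulr.
  have dp'p : (p' %| p)%N by rewrite -(Gauss_dvdl _ cpq') epq dvdn_mulr.
  have ep : p = p' by apply/eqP; rewrite eqn_dvd dpp' dp'p.
  by move/eqP: epq; rewrite -ep eqn_pmul2l // => /eqP ->.
apply: le_lt_trans Ble _.
pose s : R := Num.sqrt (2 * n%:R / (tprod c)%:R).
have CR : 0 < (tprod c)%:R :> R by rewrite ltr0n.
have nR : 0 < n%:R :> R by rewrite ltr0n.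
have s2 : s ^+ 2 = 2 * n%:R / (tprod c)%:R.
  by rewrite sqr_sqrtr // divr_ge0 ?mulr_ge0 ?ler0n.
have := @truncn_eq_dist (X * s) (X' * s).
rewrite !mulr_ge0 ?sqrtr_ge0 // => /(_ isT isT ecell).
rewrite -mulrBl exprMn s2 mulrC -lter_pdivlMl ?divr_gt0 ?mulr_gt0 // mulr1 => h.
rewrite -ltr_pdivlMl //.
suff -> : n%:R^-1 * ((tprod c)%:R / 2) = (2 * n%:R / (tprod c)%:R)^-1 :> R by [].
by field; rewrite !gt_eqF.
Qed.

(** The determinant is [k C], with [k] nonzero because the three polar values are positive. Then
    [conic_det3] has left side at least [C^3], whereas its right side is at most
    [2 (C / 2)^3 = C^3 / 4]. *)
Lemma no_three_points n p q p' q' p'' q'' pz qz (c := sqfree_parts p q)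
    (z := sqroot_parts pz qz) :
  admissible n p q -> admissible n p' q' -> admissible n p'' q'' ->
  admissible n pz qz ->
  sqfree_parts p' q' = c -> sqfree_parts p'' q'' = c -> sqfree_parts pz qz = c ->
  minor_classes c z (sqroot_parts p' q') = minor_classes c z (sqroot_parts p q) ->
  minor_classes c z (sqroot_parts p'' q'') = minor_classes c z (sqroot_parts p q) ->
  cell n (tprod c) p' q' = cell n (tprod c) p q ->
  cell n (tprod c) p'' q'' = cell n (tprod c) p q ->
  (p, q) <> (p', q') -> (p', q') <> (p'', q'') -> (p, q) <> (p'', q'') -> False.
Proof.
move=> a1 a2 a3 az e2 e3 ez m2 m3 l2 l3 n12 n23 n13.
set u := sqroot_parts p q in m2 m3; set v := sqroot_parts p' q' in m2.
set w := sqroot_parts p'' q'' in m3.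
have /andP[b12 b12'] := polar_gt0_lt a1 a2 e2 (esym l2) n12.
have /andP[b13 b13'] := polar_gt0_lt a1 a3 e3 (esym l3) n13.
have := @polar_gt0_lt n p' q' p'' q'' a2 a3; rewrite e2 => /(_ e3).
rewrite l2 l3 => /(_ erefl n23) /andP[b23 b23'].
rewrite -/u -/v -/w -/c in b12 b12' b13 b13' b23 b23'.
have [[c12 c13 c23 _ _] _] := coprime_parts a1; rewrite -/c in c12 c13 c23.
have dvd : ((tprod c)%:Z %| det3 u v w)%Z.
  apply: dvdz_det3 => // x y.
  pose good t := exists p1 q1, [/\ t = sqroot_parts p1 q1, admissible n p1 q1,
     sqfree_parts p1 q1 = c & minor_classes c z t = minor_classes c z u].
  have g t : t = u \/ t = v \/ t = w -> good t.
    by case=> [->|[->|->]]; [exists p, q|exists p', q'|exists p'', q''].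
  move=> /g[p1 [q1 [-> g1 g2 g3]]] /g[p2 [q2 [-> h1 h2 h3]]].
  by rewrite -g2; apply: (@minors_dvdz n _ _ _ _ pz qz) => //;
     rewrite g2 // g3 -h3.
have [[cu cv] cw] := (conic_parts a1, conic_parts a2, conic_parts a3).
rewrite e2 in cv; rewrite e3 in cw.
rewrite -/c -/u in cu; rewrite -/c -/v in cv; rewrite -/c -/w in cw.
have C0 : 0 < (tprod c)%:~R :> R.
  have [c1 c2 c3] := sqfree_parts_gt0 a1.
  by rewrite ltr0z ltz_nat /tprod !muln_gt0 c1 c2.
clearbody c u v w.
have := conic_det3 cu cv cw; rewrite /=.
case/dvdzP: dvd => k ->; rewrite -!PoszM -/(tprod c).
move: b12 b12' b13 b13' b23 b23'.
move: (polar _ u v) (polar _ v w) (polar _ u w) => P1 P2 P3.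
move=> b12 b12' b13 b13' b23 b23' /(congr1 toR).
have -> : toR ((tprod c)%:Z * (k * (tprod c)%:Z) ^+ 2)
   = (tprod c)%:~R * (k%:~R * (tprod c)%:~R) ^+ 2.
  by rewrite /toR intrM rmorphXn /= intrM.
have -> : toR (2 * (P1 * P2 * P3)) = 2 * (toR P1 * toR P2 * toR P3).
  by rewrite /toR !intrM.
move: b12 b12' b13 b13' b23 b23'; rewrite -pmulrn; move: C0; rewrite -pmulrn.
move: (toR P1) (toR P2) (toR P3) => x t y.
move: (_%:R) => C C0 x0 xC y0 yC t0 tC e.
have k0 : k != 0.
  apply: contraTneq (_ : 0 < 2 * (x * t * y)); last by rewrite !mulr_gt0.
  by move=> k00; rewrite -e k00 mulr0z mul0r expr0n mulr0 ltxx.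
have k1 : 1 <= (k%:~R : R) ^+ 2.
  by rewrite -rmorphXn -[1]/(1%:~R) ler_int; lia.
have h1 : x * t <= (C / 2) * (C / 2) by apply: ler_pM => //; exact: ltW.
have h2 : x * t * y <= (C / 2) * (C / 2) * (C / 2).
  by apply: ler_pM => //; [rewrite mulr_ge0 //; exact: ltW|exact: ltW|exact: ltW].
have h3 : C ^+ 3 <= C * (k%:~R * C) ^+ 2.
  by rewrite exprMn mulrCA -exprS ler_peMl // exprn_ge0 // ltW.
have := exprn_gt0 3 C0; move: h2 h3; rewrite e.
have -> : C / 2 * (C / 2) * (C / 2) = C ^+ 3 / 8 by field.
lra.
Qed.

End ThreePoints.

(** * Counting coprime sums with small squarefree parts *)

Lemma card_le_fibers2 (T : finType) (S : {set T}) (f : T -> nat) (k : nat) :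
  {in S, forall x, (f x <= k)%N} ->
  (forall a b c, a \in S -> b \in S -> c \in S -> f b = f a -> f c = f a ->
     a <> b -> b <> c -> a <> c -> False) ->
  (#|S| <= 2 * k.+1)%N.
Proof.
move=> fk h; pose F x : 'I_k.+1 := inord (f x).
have -> : #|S| = (\sum_(i < k.+1) #|[set x in S | F x == i]|)%N.
  rewrite -sum1_card (partition_big F xpredT) //=; apply: eq_bigr => i _.
  by rewrite -sum1_card; apply: eq_bigl => x; rewrite inE.
rewrite mulnC -[k.+1 in leqRHS]card_ord -sum_nat_const; apply: leq_sum => i _.
rewrite leqNgt; apply/negP => /card_gt2P[a [b [c [[]]]]].
rewrite !inE => /andP[aS /eqP ai] /andP[bS /eqP bi] /andP[cS /eqP ci] [ab bc ca].
have e x y : x \in S -> y \in S -> F x = i -> F y = i -> f x = f y.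
  move=> xS yS <- /(congr1 (fun j : 'I_k.+1 => j : nat)).
  by rewrite !inordK ?ltnS ?fk.
apply: (h a b c) => //; try exact: e; try exact/eqP.
by apply/eqP; rewrite eq_sym.
Qed.

(** * Harmonic and divisor sums *)

Section Harmonic.
Variable R : realType.

(** The index starts at 0 harmlessly, since [0^-1 = 0]. *)
Definition harmonic_sum (y : nat) : R := \sum_(k < y.+1) k%:R^-1.

Lemma harmonic_sum_ge0 y : 0 <= harmonic_sum y.
Proof. by apply: sumr_ge0 => i _; rewrite invr_ge0. Qed.

(** Induction with [1 / (y + 1) <= ln (y + 1) - ln y], which is [ln (1 - t) <= - t] at
    [t = 1 / (y + 1)]. *)
Lemma harmonic_sum_le_ln y : (0 < y)%N -> harmonic_sum y <= 1 + ln y%:R.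
Proof.
elim: y => // -[|y] IH _.
  by rewrite /harmonic_sum !big_ord_recr big_ord0 /= ln1 invr0 invr1 !addr0 add0r.
rewrite /harmonic_sum big_ord_recr /= -/(harmonic_sum y.+1).
have {}IH := IH isT.
suff h : y.+2%:R^-1 <= ln y.+2%:R - ln y.+1%:R :> R.
  by apply: (le_trans (lerD IH h)); rewrite -addrA lerD2l addrC subrK.
have y1 : 0 < y.+1%:R :> R by [].
have y2 : 0 < y.+2%:R :> R by [].
have : ln (1 + (- y.+2%:R^-1)) <= - y.+2%:R^-1 :> R.
  by apply: le_ln1Dx; rewrite ltrN2 invf_lt1 // ltr1n.
have -> : 1 + (- y.+2%:R^-1) = y.+1%:R / y.+2%:R :> R.
  have -> : y.+1%:R = y.+2%:R - 1 :> R by rewrite -[y.+2%:R]natr1 addrK.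
  by field; rewrite gt_eqF.
by rewrite ln_div ?posrE // -lerN2 opprK opprB.
Qed.

Definition divisor_weight (c g : nat) : R := if (g %| c)%N then c%:R^-1 else 0.

Lemma divisor_weight_ge0 c g : 0 <= divisor_weight c g.
Proof. by rewrite /divisor_weight; case: ifP => // _; rewrite invr_ge0. Qed.

(** This sums [tau(c) / c]. Writing [c = g h] and dropping the constraint [g h <= y] leaves a
    product of two harmonic sums. *)
Lemma sum_divisor_weight y :
  \sum_(x : 'I_y.+1 * 'I_y.+1) divisor_weight x.1 x.2 <= harmonic_sum y ^+ 2.
Proof.
rewrite -(pair_bigA _ (fun c g : 'I_y.+1 => divisor_weight c g)) /=.
apply: (@le_trans _ _ (\sum_(c < y.+1) \sum_(g < y.+1) \sum_(h < y.+1 | (g * h)%N == c)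
    g%:R^-1 * h%:R^-1)).
  apply: ler_sum => c _; apply: ler_sum => g _.
  have ge0 (P : pred 'I_y.+1) : 0 <= \sum_(h < y.+1 | P h) (g%:R^-1 * h%:R^-1 : R).
    by apply: sumr_ge0 => h _; rewrite mulr_ge0 ?invr_ge0.
  rewrite /divisor_weight; case: ifP => // gc.
  have [c0|c0] := posnP c; first by rewrite c0 invr0.
  have hy : (c %/ g < y.+1)%N by rewrite (leq_ltn_trans (leq_div _ _)).
  rewrite (bigD1 (Ordinal hy)) /=; last by rewrite mulnC divnK.
  by rewrite -invfM -natrM mulnC divnK // lerDl.
rewrite expr2 /harmonic_sum big_distrl /= exchange_big /=; apply: ler_sum => g _.
rewrite big_distrr /=.
under eq_bigr => c _ do rewrite big_mkcond /=.
rewrite exchange_big /=; apply: ler_sum => h _.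
rewrite -big_mkcond /=.
have gh : 0 <= g%:R^-1 * h%:R^-1 :> R by rewrite mulr_ge0 ?invr_ge0.
have [ghy|ghy] := ltnP (g * h)%N y.+1.
  rewrite (big_pred1 (Ordinal ghy)) // => c; exact/idP/idP.
rewrite big_pred0 // => c; apply/negbTE/eqP => e.
by move: (ltn_ord c); rewrite -e ltnNge ghy.
Qed.

End Harmonic.

(** * Counting pairs by conic, class and arc *)

Section Count.
Variable R : realType.
Variables n y : nat.

Definition conic_pairs : {set 'I_n.+1 * 'I_n.+1} :=
  [set x : 'I_n.+1 * 'I_n.+1 | admissible n x.1 x.2 & (tprod (sqfree_parts x.1 x.2) <= y)%N].

(** A base point chosen once per conic, against which classes are measured; the default occurs only
    for a conic without counted pairs. *)
Definition reference_pair (c : nat * nat * nat) : 'I_n.+1 * 'I_n.+1 :=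
  odflt (ord0, ord0) [pick x in conic_pairs | sqfree_parts x.1 x.2 == c].

Definition conic_code (x : 'I_n.+1 * 'I_n.+1) :
    nat * nat * nat * (nat * nat * nat) :=
  let c := sqfree_parts x.1 x.2 in
  let z := reference_pair c in
  (c, minor_classes c (sqroot_parts z.1 z.2) (sqroot_parts x.1 x.2)).

Lemma reference_pairP (x : 'I_n.+1 * 'I_n.+1) (c := sqfree_parts x.1 x.2) : x \in conic_pairs ->
  admissible n (reference_pair c).1 (reference_pair c).2 /\
  sqfree_parts (reference_pair c).1 (reference_pair c).2 = c.
Proof.
move=> xS; rewrite /reference_pair; case: pickP => [z /andP[zS /eqP e]|/(_ x)].
  by move: zS; rewrite inE => /andP[].
by rewrite xS eqxx.
Qed.

(** Equal codes mean the same conic and class, so each arc carries at most two pairs; abscissas are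
    at most 1, which leaves [truncn s + 1] arcs. *)
Lemma card_conic_code_fiber k (C := tprod k.1) : (0 < C)%N ->
  (#|[set x in conic_pairs | conic_code x == k]|)%:R
    <= 2 * (1 + Num.sqrt (2 * n%:R / C%:R)) :> R.
Proof.
move=> C0; set s : R := Num.sqrt _.
have s0 : 0 <= s by apply: sqrtr_ge0.
apply: (@le_trans _ _ (2 * (Num.truncn s).+1)%:R).
  rewrite ler_nat; apply: (@card_le_fibers2 _ _ (fun x : 'I_n.+1 * 'I_n.+1 => cell R n C x.1 x.2)).
    move=> x; rewrite !inE => /andP[/andP[/and4P[p0 _ _ _] _] _].
    apply: le_truncn; rewrite ler_piMl // -[leRHS]sqrtr1 ler_wsqrtr //.
    by rewrite ler_pdivrMr ?mul1r ?ler_nat ?leq_addr // ltr0n addn_gt0 p0.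
  have memE (x : 'I_n.+1 * 'I_n.+1) :
      (x \in [set x in conic_pairs | conic_code x == k]) =
      (x \in conic_pairs) && (conic_code x == k) by rewrite [LHS]inE.
  move=> a b c; rewrite !memE.
  move=> /andP[aS /eqP ea] /andP[bS /eqP eb] /andP[cS /eqP ec] lb lc nab nbc nac.
  have adm (x : 'I_n.+1 * 'I_n.+1) : x \in conic_pairs -> admissible n x.1 x.2 by rewrite inE => /andP[].
  have [az ez] := reference_pairP aS.
  have ck (x : 'I_n.+1 * 'I_n.+1) : conic_code x = k -> sqfree_parts x.1 x.2 = k.1 by move=> <-.
  have mk (x : 'I_n.+1 * 'I_n.+1) : conic_code x = k -> minor_classes k.1
      (sqroot_parts (reference_pair k.1).1 (reference_pair k.1).2) (sqroot_parts x.1 x.2) = k.2.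
    by move=> <-.
  have nn (x x' : 'I_n.+1 * 'I_n.+1) : x <> x' ->
      (x.1 : nat, x.2 : nat) <> (x'.1 : nat, x'.2 : nat).
    move: x x' => [x1 x2] [x1' x2'] /= nx [e1 e2]; apply: nx.
    by congr pair; apply: val_inj.
  apply: (@no_three_points R n a.1 a.2 b.1 b.2 c.1 c.2
     (reference_pair k.1).1 (reference_pair k.1).2);
     rewrite ?(ck a ea); try exact: adm; try exact: nn; try exact: ck.
  - by rewrite -(ck a ea).
  - by move: ez; rewrite (ck a ea).
  - by rewrite !mk.
  - by rewrite !mk.
  - by [].
  - by [].
rewrite natrM ler_pM2l // -natr1 addrC lerD2l.
by have /andP[] := truncn_itv s0.
Qed.

(** For [C <= y] the fibre bound is at most [M / C], and [1 / C] is the product of three divisor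
    weights, so the sum over codes factors into three sums. *)
Lemma card_conic_pairs : #|conic_pairs|%:R
  <= 2 * (y%:R + 2 * Num.sqrt (n%:R * y%:R)) * harmonic_sum R y ^+ 6.
Proof.
pose T := ('I_y.+1 * 'I_y.+1)%type.
(* A version of [conic_code] in a finite type. Nothing is lost on [conic_pairs]: there every
   coefficient, hence each of its divisors, is at most [y]. *)
pose code (x : 'I_n.+1 * 'I_n.+1) : T * T * T :=
  let k := conic_code x in
  ((inord k.1.1.1, inord k.2.1.1), (inord k.1.1.2, inord k.2.1.2),
   (inord k.1.2, inord k.2.2)).
pose val_code (t : T * T * T) : nat * nat * nat * (nat * nat * nat) :=
  ((t.1.1.1 : nat, t.1.2.1 : nat, t.2.1 : nat),
   (t.1.1.2 : nat, t.1.2.2 : nat, t.2.2 : nat)).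
have codeP x : x \in conic_pairs -> [/\ conic_code x = val_code (code x),
    (0 < tprod (conic_code x).1 <= y)%N &
    [/\ (conic_code x).2.1.1 %| (conic_code x).1.1.1,
     (conic_code x).2.1.2 %| (conic_code x).1.1.2 &
     (conic_code x).2.2 %| (conic_code x).1.2]%N].
  rewrite inE => /andP[ax]; rewrite -[sqfree_parts _ _]/(conic_code x).1 => xy.
  have cp : [/\ 0 < (conic_code x).1.1.1, 0 < (conic_code x).1.1.2
    & 0 < (conic_code x).1.2]%N := sqfree_parts_gt0 ax.
  have g1 : ((conic_code x).2.1.1 %| (conic_code x).1.1.1)%N by apply: dvdn_gcdl.
  have g2 : ((conic_code x).2.1.2 %| (conic_code x).1.1.2)%N by apply: dvdn_gcdl.
  have g3 : ((conic_code x).2.2 %| (conic_code x).1.2)%N by apply: dvdn_gcdl.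
  rewrite /val_code /code.
  move: (conic_code x) g1 g2 g3 xy cp => [[[c1 c2] c3] [[h1 h2] h3]] /=.
  rewrite /tprod /= => g1 g2 g3 xy [c1p c2p c3p].
  have [l1 l2 l3] : [/\ c1 <= y, c2 <= y & c3 <= y]%N.
    split; apply: leq_trans xy.
    - by rewrite -mulnA leq_pmulr // muln_gt0 c2p.
    - by rewrite -mulnA mulnCA leq_pmulr // muln_gt0 c1p.
    - by rewrite leq_pmull // muln_gt0 c1p.
  have := dvdn_leq c1p g1; have := dvdn_leq c2p g2; have := dvdn_leq c3p g3.
  move=> m3 m2 m1; split => //; last by rewrite xy !muln_gt0 c1p c2p c3p.
  have [k1 k2 k3] := And3 (leq_trans m1 l1) (leq_trans m2 l2) (leq_trans m3 l3).
  by rewrite !inordK.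
have -> : #|conic_pairs| =
    (\sum_(t : T * T * T) #|[set x in conic_pairs | code x == t]|)%N.
  rewrite -sum1_card (partition_big code xpredT) //=; apply: eq_bigr => t _.
  by rewrite -sum1_card; apply: eq_bigl => x; rewrite [RHS]inE.
set M := 2 * (_ + _).
have M0 : 0 <= M by rewrite !mulr_ge0 ?addr_ge0 ?mulr_ge0 ?sqrtr_ge0.
have -> : harmonic_sum R y ^+ 6 = harmonic_sum R y ^+ 2 * harmonic_sum R y ^+ 2 * harmonic_sum R y ^+ 2.
  by rewrite -!exprD.
pose w (x : T) : R := divisor_weight R x.1 x.2.
have w0 x : 0 <= w x by apply: divisor_weight_ge0.
have sw := sum_divisor_weight R y; rewrite -/w in sw.
have sw0 : 0 <= \sum_x w x by apply: sumr_ge0.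
apply: (@le_trans _ _ (M * ((\sum_x w x) * (\sum_x w x) * (\sum_x w x)))); last first.
  rewrite ler_wpM2l //; apply: ler_pM => //; first exact: mulr_ge0.
  by apply: ler_pM.
have -> : (\sum_x w x) * (\sum_x w x) * (\sum_x w x) =
    \sum_(t : T * T * T) w t.1.1 * w t.1.2 * w t.2.
  by rewrite big_distrlr /= pair_bigA big_distrlr /= pair_bigA.
rewrite natr_sum mulr_sumr; apply: ler_sum => t _.
have [->|[x]] := set_0Vmem [set x in conic_pairs | code x == t].
  by rewrite cards0 !mulr_ge0.
rewrite [x \in _]inE => /andP[xS /eqP ct].
have [kx /andP[C0 Cy] [g1 g2 g3]] := codeP x xS; rewrite ct in kx.
rewrite kx in C0 Cy g1 g2 g3.
have sub : [set x in conic_pairs | code x == t]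
    \subset [set x in conic_pairs | conic_code x == val_code t].
  apply/fintype.subsetP => x'; rewrite [x' \in _]inE => /andP[x'S /eqP ct'].
  rewrite [x' \in _]inE x'S /=; apply/eqP.
  by have [-> _ _] := codeP x' x'S; rewrite ct'.
have /(_ C0) := @card_conic_code_fiber (val_code t).
have := subset_leq_card sub; rewrite -(ler_nat R) => /le_trans h /h {h}.
move=> /le_trans; apply.
rewrite /w /divisor_weight g1 g2 g3 -!invfM -!natrM -/(tprod (val_code t).1).
move: (tprod (val_code t).1) C0 Cy => C C0 Cy.
have CR : 0 < C%:R :> R by rewrite ltr0n.
have CyR : C%:R <= y%:R :> R by rewrite ler_nat.
rewrite /M -mulrA ler_pM2l // mulrDl lerD //.
  by rewrite ler_pdivlMr // mul1r.
have s0 : 0 <= 2 * Num.sqrt (n%:R * y%:R) / C%:R :> R.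
  by rewrite divr_ge0 ?mulr_ge0 ?sqrtr_ge0.
rewrite -[leRHS](ger0_norm s0) -sqrtr_sqr ler_wsqrtr //.
have -> : (2 * Num.sqrt (n%:R * y%:R) / C%:R) ^+ 2 =
    4 * Num.sqrt (n%:R * y%:R) ^+ 2 / C%:R ^+ 2 :> R by field; rewrite gt_eqF.
rewrite sqr_sqrtr ?mulr_ge0 // -subr_ge0.
set D := (X in 0 <= X).
have -> : D = 2 * n%:R * (2 * y%:R - C%:R) / C%:R ^+ 2.
  by rewrite /D; field; rewrite gt_eqF.
rewrite divr_ge0 ?exprn_ge0 // !mulr_ge0 //; have := ler0n R y; lra.
Qed.

End Count.

(** * From the quartic form to coprime sums *)

(** For [b < a], the value of [x^3 - x] at [x = a / b], up to the square factor [b^4]. *)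
Definition quartic (x : nat * nat) : nat :=
  (x.1 * x.2 * (x.1 - x.2) * (x.1 + x.2))%N.

Section Reduction.
Local Open Scope nat_scope.

(* This is translation by a rational 2-torsion point. *)
Lemma odd_representative a b : 0 < b < a -> coprime a b ->
  exists a' b', [/\ 0 < b' < a', coprime a' b', odd (a' + b'), a' <= a &
    sqfree_part (quartic (a', b')) = sqfree_part (quartic (a, b))].
Proof.
move=> /andP[b0 ba] cab; have [oab|eab] := boolP (odd (a + b)).
  by exists a, b; split=> //; rewrite b0.
(* Here [a] and [b] are both odd, and [quartic (a, b)] is four times [quartic (f, e)]. *)
pose f := (a + b)./2; pose e := (a - b)./2.
have fE : a + b = f + f.
  by rewrite -{1}(odd_double_half (a + b)) (negPf eab) add0n addnn.
have eE : a - b = e + e.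
  by rewrite -{1}(odd_double_half (a - b)) oddB 1?ltnW // -oddD (negPf eab) add0n addnn.
have aE : a = f + e by lia.
have bE : b = f - e by lia.
have ef : 0 < e < f by lia.
have oa : odd a.
  apply/negPn/negP => na; move: cab eab; rewrite oddD (negPf na) /= => cab nb.
  have : 2 %| gcdn a b by rewrite dvdn_gcd !dvdn2 na nb.
  by rewrite (eqP cab).
exists f, e; split => //.
- rewrite /coprime -dvdn1 -(eqP cab) dvdn_gcd aE bE.
  by rewrite dvdn_add ?dvdn_sub ?dvdn_gcdl ?dvdn_gcdr.
- by rewrite -aE.
- lia.
have q0 : 0 < quartic (f, e) by rewrite /quartic /= !muln_gt0; lia.
have -> : quartic (a, b) = quartic (f, e) * 2 ^ 2.
  by rewrite /quartic /= eE fE -aE -bE; lia.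
have d1 := squarefree_sqfree_part q0.
apply/esym; apply: (@sqfree_part_eq _ (sqroot_part (quartic (f, e)) * 2) _ 1) => //.
- by rewrite muln_gt0 sqroot_part_gt0.
- by rewrite muln_gt0 q0.
by rewrite exp1n muln1 expnMn mulnA -sqfree_partE.
Qed.

(** Some factor is at least [d^(1/4)], and the other three have product at most [d^(3/4)]; fourth
    powers keep this integral. *)
Lemma three_of_four s1 s2 s3 s4 (d := s1 * s2 * s3 * s4) : 0 < d ->
  [\/ (s1 * s2 * s3) ^ 4 <= d ^ 3, (s1 * s2 * s4) ^ 4 <= d ^ 3,
      (s1 * s3 * s4) ^ 4 <= d ^ 3 | (s2 * s3 * s4) ^ 4 <= d ^ 3].
Proof.
move=> d0.
have key P s : P * s = d -> d <= s ^ 4 -> P ^ 4 <= d ^ 3.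
  move=> e ds; rewrite -(leq_pmul2r d0) -expnSr -{2}e expnMn.
  by rewrite leq_mul.
have [h|h4] := leqP d (s4 ^ 4); first by apply: Or41; apply: key h.
have [h|h3] := leqP d (s3 ^ 4).
  by apply: Or42; apply: key h; rewrite mulnAC.
have [h|h2] := leqP d (s2 ^ 4).
  by apply: Or43; apply: key h; rewrite /d; lia.
have [h|h1] := leqP d (s1 ^ 4).
  by apply: Or44; apply: key h; rewrite /d; lia.
have := ltn_mul (ltn_mul (ltn_mul h1 h2) h3) h4.
by rewrite -!expnMn -/d !expnS expn0 muln1 !mulnA ltnn.
Qed.

(* Recovers [(a, b)] from [(b, a - b)], [(a, b)], [(a - b, a + b)] and
   [(a - b, 2 b)] respectively. *)
Definition undo (t : 'I_4) (x : nat * nat) : nat * nat :=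
  nth (0, 0) [:: (x.1 + x.2, x.1); x; ((x.1 + x.2)./2, (x.2 - x.1)./2);
                 (x.1 + x.2./2, x.2./2)] t.

Definition swap_if (s : bool) (x : nat * nat) : nat * nat :=
  if s then (x.2, x.1) else x.

(** Pairs in [conic_pairs] are ordered; the bit [s] restores the original order. *)
Lemma conic_pairs_swap n y p q : 0 < p -> 0 < q -> coprime p q -> p + q <= n ->
  sqfree_part p * sqfree_part q * sqfree_part (p + q) <= y ->
  exists s (x : 'I_n.+1 * 'I_n.+1), x \in conic_pairs n y /\
    swap_if s (x.1 : nat, x.2 : nat) = (p, q).
Proof.
move=> p0 q0 cpq pqn hy.
have pn : p < n.+1 by lia.
have qn : q < n.+1 by lia.
have [pq|pq] := leqP p q.
  exists false, (Ordinal pn, Ordinal qn); split => //.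
  by rewrite inE /= /admissible p0 pq cpq pqn /tprod.
exists true, (Ordinal qn, Ordinal pn); split => //.
rewrite inE /= /admissible q0 (ltnW pq) coprime_sym cpq addnC pqn /tprod /=.
by rewrite addnC [sqfree_part q * _]mulnC.
Qed.

Lemma sqfree_part_double n : 0 < n -> sqfree_part (2 * n) <= 2 * sqfree_part n.
Proof.
move=> n0; rewrite {1}(sqfree_partE n0) mulnA; apply: sqfree_part_le.
by rewrite -mulnA -sqfree_partE // muln_gt0.
Qed.

(** With [e = a - b], each choice of three factors has its relation: [b + e = a], [a + b = (a + b)],
    [e + (a + b) = 2 a], [e + 2 b = a + b]. The last two double a factor, whence [2 * P]; oddness of
    [e] keeps the summands coprime. *)
Lemma conic_pairs_undo m y a b : 0 < b < a -> a <= m -> coprime a b ->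
  odd (a + b) ->
  (forall P, P ^ 4 <= sqfree_part (quartic (a, b)) ^ 3 -> 2 * P <= y) ->
  exists t s (x : 'I_(2 * m).+1 * 'I_(2 * m).+1),
    x \in conic_pairs (2 * m) y /\
    undo t (swap_if s (x.1 : nat, x.2 : nat)) = (a, b).
Proof.
move=> /andP[b0 ba] am cab oab hy.
pose e := a - b; have e0 : 0 < e by rewrite subn_gt0.
have aE : a = e + b by rewrite subnK // ltnW.
have ceb : coprime e b by move: cab; rewrite aE /coprime gcdnC gcdnDr gcdnC.
have oe : odd e by move: oab; rewrite aE -addnA addnn oddD odd_double addbF.
have ce2 : coprime e 2 by rewrite coprimen2.
have cae : coprime a e by rewrite aE /coprime gcdnC gcdnDl.
have cas : coprime a (a + b) by rewrite /coprime gcdnDl.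
have cbs : coprime b (a + b) by rewrite /coprime gcdnDr gcdnC.
have ce2b : coprime e (2 * b) by rewrite coprimeMr ce2.
have ces : coprime e (a + b) by rewrite aE -addnA addnn -mul2n /coprime gcdnDl.
have a0 : 0 < a by lia.
have s0 : 0 < a + b by lia.
have dE : sqfree_part (quartic (a, b)) =
    sqfree_part a * sqfree_part b * sqfree_part e * sqfree_part (a + b).
  have ab0 : 0 < a * b by rewrite muln_gt0 a0.
  have abe0 : 0 < a * b * e by rewrite muln_gt0 ab0.
  have c1 : coprime (a * b) e by rewrite coprimeMl cae coprime_sym.
  have c2 : coprime (a * b * e) (a + b) by rewrite !coprimeMl cas cbs.
  by rewrite /quartic (sqfree_partM abe0 s0 c2) (sqfree_partM ab0 e0 c1) sqfree_partM.
rewrite dE in hy.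
have fin (t : 'I_4) p q : 0 < p -> 0 < q -> coprime p q -> p + q <= 2 * m ->
    sqfree_part p * sqfree_part q * sqfree_part (p + q) <= y ->
    undo t (p, q) = (a, b) ->
    exists t s (x : 'I_(2 * m).+1 * 'I_(2 * m).+1),
      x \in conic_pairs (2 * m) y /\
      undo t (swap_if s (x.1 : nat, x.2 : nat)) = (a, b).
  move=> p0 q0 cpq pqm /(conic_pairs_swap p0 q0 cpq pqm)[s [x [xS xE]]] tE.
  by exists t, s, x; rewrite xE.
have d0 : 0 < sqfree_part a * sqfree_part b * sqfree_part e * sqfree_part (a + b).
  by rewrite !muln_gt0 !sqfree_part_gt0.
case: (three_of_four d0) => /hy hP.
- apply: (fin (@Ordinal 4 0 isT) b e) => //; rewrite 1?coprime_sym //.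
  + by rewrite addnC -aE; lia.
  + by rewrite (addnC b) -aE; nia.
  + by rewrite /undo /= addnC -aE.
- apply: (fin (@Ordinal 4 1 isT) a b) => //; first lia.
  lia.
- apply: (fin (@Ordinal 4 2 isT) e (a + b)) => //; first lia.
  + have -> : e + (a + b) = 2 * a by lia.
    apply: leq_trans (leq_mul (leqnn _) (sqfree_part_double a0)) _.
    by apply: leq_trans hP; rewrite mulnC -!mulnA.
  + by rewrite /undo /=; congr pair; lia.
- apply: (fin (@Ordinal 4 3 isT) e (2 * b)) => //.
  + by rewrite muln_gt0.
  + lia.
  + have -> : e + 2 * b = a + b by lia.
    apply: leq_trans (leq_mul (leq_mul (leqnn _) (sqfree_part_double b0)) (leqnn _)) _.
    by apply: leq_trans hP; rewrite !mulnA; lia.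
  + by rewrite /undo /= mul2n doubleK -aE.
Qed.

End Reduction.

(** A pair, one of four relations and the order bit determine [d], whence the factor 8. *)
Lemma card_quartic_le (m y : nat) (A : {fset nat}) :
  (forall d, d \in A -> exists a b, [/\ (0 < b < a)%N, (a <= m)%N, coprime a b,
     d = sqfree_part (quartic (a, b)) &
     forall P, (P ^ 4 <= d ^ 3)%N -> (2 * P <= y)%N]) ->
  (#|` A| <= 8 * #|conic_pairs (2 * m) y|)%N.
Proof.
move=> hA; pose n := (2 * m)%N.
pose g (k : 'I_4 * bool) (x : 'I_n.+1 * 'I_n.+1) : nat :=
  sqfree_part (quartic (undo k.1 (swap_if k.2 (x.1 : nat, x.2 : nat)))).
pose s := [seq g k x | k <- enum {: 'I_4 * bool}, x <- enum (conic_pairs n y)].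
have -> : (8 * #|conic_pairs n y|)%N = size s.
  by rewrite size_allpairs -!cardE card_prod card_ord card_bool.
apply: uniq_leq_size; first exact: fset_uniq.
move=> d /hA[a [b [ba am cab dE hy]]].
have [a' [b' [ba' cab' o' a'a qE]]] := odd_representative ba cab.
have [||t [s' [x [xS xE]]]] := @conic_pairs_undo m y a' b' ba' _ cab' o'.
- exact: leq_trans am.
- by rewrite qE -dE.
apply/allpairsP; exists ((t, s'), x); rewrite !mem_enum; split => //=.
by rewrite /g xE qE.
Qed.

(** * Heights *)

Definition rat_height (x : rat) : nat := maxn `|numq x| `|denq x|.

Lemma rat_height_gt0 x : (0 < rat_height x)%N.
Proof. by rewrite leq_max [X in _ || X]absz_gt0 denq_eq0 orbT. Qed.

Lemma rat_height_eq_div (a b k : int) (x : rat) :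
  a = k * numq x -> b = k * denq x ->
  (maxn `|a| `|b| = `|k| * rat_height x)%N.
Proof. by move=> -> ->; rewrite !abszM maxnMr. Qed.

(** As [a^2 + b^2] is coprime to [a b], so is [k], which thus divides [4 (a^2 - b^2)]; then [(a^2 +
    b^2)^2 - (a^2 - b^2)^2 = 4 a^2 b^2] removes everything but 16. *)
Lemma gcd_duplication (a b k : int) : coprimez a b ->
  (k %| (a ^+ 2 + b ^+ 2) ^+ 2)%Z -> (k %| 4 * (a * b * (a ^+ 2 - b ^+ 2)))%Z ->
  (k %| 16)%Z.
Proof.
move=> cab k1 k2.
have ca : coprimez (a ^+ 2 + b ^+ 2) a.
  by rewrite coprimez_sym /coprimez expr2 gcdzMDl -/(coprimez _ _) coprimezXr.
have cb : coprimez (a ^+ 2 + b ^+ 2) b.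
  rewrite coprimez_sym /coprimez addrC [b ^+ 2]expr2 gcdzMDl -/(coprimez _ _).
  by rewrite coprimezXr // coprimez_sym.
have cA : coprimez ((a ^+ 2 + b ^+ 2) ^+ 2) (a * b).
  by rewrite coprimezXl // coprimezMr ca.
have cka : coprimez k (a * b) by apply: coprimez_dvdl cA.
have k3 : (k %| 4 * (a ^+ 2 - b ^+ 2))%Z.
  by rewrite -(Gauss_dvdzr _ cka) mulrCA.
have : (k %| (a * b) ^+ 2 * 16)%Z.
  have -> : (a * b) ^+ 2 * 16 = 4 * (a ^+ 2 + b ^+ 2) ^+ 2
    - (a ^+ 2 - b ^+ 2) * (4 * (a ^+ 2 - b ^+ 2)) by ring.
  by rewrite rpredB // dvdz_mull.
by rewrite Gauss_dvdzr // coprimezXr.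
Qed.

Lemma norm_sub_le_max (u v w : int) :
  0 <= v -> 0 <= u -> v <= w -> u <= w -> `|u - v| <= w.
Proof. by move=> *; lia. Qed.

(** For [x = a / b] of height [H], the unreduced fraction [A / D] for [x'] has height between [H^4]
    and [4 H^4], and cancellation removes a factor of at most 16. *)
Lemma rat_height_duplication (x : rat) (x' := (x ^+ 2 + 1) ^+ 2 / (4 * (x ^+ 3 - x))) :
  x ^+ 3 - x != 0 ->
  (rat_height x ^ 4 <= 16 * rat_height x')%N /\
  (rat_height x' <= 4 * rat_height x ^ 4)%N.
Proof.
move=> x0; set a := numq x; set b := denq x.
have b0 : (b%:~R : rat) != 0 by rewrite intr_eq0 denq_eq0.
have xE : x = a%:~R / b%:~R by rewrite divq_num_den.
pose A := (a ^+ 2 + b ^+ 2) ^+ 2; pose D := 4 * (a * b * (a ^+ 2 - b ^+ 2)).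
have D0 : (D%:~R : rat) = 4 * b%:~R ^+ 4 * (x ^+ 3 - x).
  by rewrite /D !rmorphM !rmorphB !rmorphXn /= xE; field.
have x'E : x' = A%:~R / D%:~R.
  rewrite D0 /x' /A !rmorphXn !rmorphD !rmorphXn /=.
  have -> : a%:~R = x * b%:~R by rewrite xE divfK.
  by field; rewrite b0 x0.
have Dn0 : D != 0 by rewrite -(intr_eq0 rat) D0 !mulf_neq0 // expf_neq0.
clearbody x'.
have [k [kA kD]] : exists k : int, A = k * numq x' /\ D = k * denq x'.
  move: x'E; case: (divqP A D) => [D00|k y k0 ->]; first by rewrite D00 in Dn0.
  by exists k.
have k16 : (k %| 16)%Z.
  apply: (@gcd_duplication a b); first by rewrite coprimezE coprime_num_den.
    by rewrite -/A kA dvdz_mulr.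
  by rewrite -/D kD dvdz_mulr.
have kle : (`|k| <= 16)%N by apply: dvdn_leq.
have k0 : (0 < `|k|)%N by rewrite absz_gt0; apply: contraNneq Dn0 => k00; rewrite kD k00 mul0r.
have hm := rat_height_eq_div kA kD.
have la : (`|a| <= rat_height x)%N by apply: leq_maxl.
have lb : (`|b| <= rat_height x)%N by apply: leq_maxr.
have AE : (`|A| = (`|a| ^ 2 + `|b| ^ 2) ^ 2)%N.
  apply/eqP; rewrite -eqz_nat abszE ger0_norm ?exprn_even_ge0 // /A.
  by rewrite -!mulnn !PoszM !PoszD !PoszM !abszE -!expr2 !real_normK ?num_real.
split.
  apply: (@leq_trans (maxn `|A| `|D|)); last by rewrite hm leq_mul2r kle orbT.
  apply: leq_trans (leq_maxl _ _); rewrite AE.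
  rewrite (expnM _ 2 2) leq_exp2r // /rat_height -/a -/b.
  by case: (leqP `|a| `|b|) => _; rewrite (leq_addl, leq_addr).
apply: (@leq_trans (maxn `|A| `|D|)); first by rewrite hm leq_pmull.
rewrite geq_max; apply/andP; split.
  rewrite AE (_ : (4 = 2 ^ 2)%N) // -[(2 ^ 2 * _)%N]/(2 ^ 2 * _ ^ (2 * 2))%N expnM -expnMn leq_exp2r //.
  by rewrite mul2n -addnn leq_add // leq_exp2r.
rewrite /D !abszM leq_mul2l /= (_ : 4 = (1 + 1 + 2))%N // !expnD !expn1.
rewrite !leq_mul //.
have sq z : (`|z| <= rat_height x)%N -> z ^+ 2 <= (rat_height x)%:Z ^+ 2.
  by move=> lz; rewrite -(real_normK (num_real z)) -abszE lerXn2r ?nnegrE ?lez_nat.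
have := sq _ la; have := sq _ lb.
have := sqr_ge0 a; have := sqr_ge0 b.
rewrite -lez_nat PoszM -expr2 abszE.
exact: norm_sub_le_max.
Qed.

Local Open Scope classical_set_scope.

Section Heights.
Variable R : realType.

Lemma height_x_Affine x y : height_x R (Affine x y) = ln (rat_height x)%:R.
Proof. by []. Qed.

Lemma addp_double d x y : (0 < d)%N -> on_curve d (Affine x y) -> y != 0 ->
  x ^+ 3 - x != 0 /\ exists y',
  addp d (Affine x y) (Affine x y)
    = Affine ((x ^+ 2 + 1) ^+ 2 / (4 * (x ^+ 3 - x))) y'.
Proof.
move=> d0 /= e y0.
have dN0 : (d%:R : rat) != 0 by rewrite pnatr_eq0 -lt0n.
have nz : x ^+ 3 - x != 0 by rewrite -e mulf_neq0 // expf_neq0.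
split=> //; rewrite eqxx /=.
have -> : (y == - y) = false.
  by apply/negbTE; rewrite -subr_eq0 opprK -mulr2n mulrn_eq0.
set l := _ / _.
have lE : d%:R * l ^+ 2 = (3 * x ^+ 2 - 1) ^+ 2 / (4 * (x ^+ 3 - x)).
  by rewrite -e /l; field; rewrite y0 dN0.
exists (l * (x - (d%:R * l ^+ 2 - x - x)) - y); congr Affine; rewrite lE.
by field; rewrite nz.
Qed.

Lemma addp_double0 d x : addp d (Affine x 0) (Affine x 0) = Infinity.
Proof. by rewrite /= eqxx oppr0 eqxx. Qed.

Lemma height_x_on_curve0 d x : on_curve d (Affine x 0) ->
  height_x R (Affine x 0) = 0.
Proof.
rewrite /= expr0n mulr0 => /esym/eqP.
have -> : x ^+ 3 - x = x * (x - 1) * (x + 1) by ring.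
rewrite !mulf_eq0 subr_eq0 addr_eq0 => /orP[/orP[]|] /eqP ->; exact: ln1.
Qed.

(** The logarithm of [rat_height_duplication], uniform in [d]; at [Infinity] and at 2-torsion points
    all heights involved vanish. *)
Lemma height_x_double d P : (0 < d)%N -> on_curve d P ->
  `|height_x R (addp d P P) - 4 * height_x R P| <= ln 16.
Proof.
have L0 : 0 <= ln 16 :> R by apply: ln_ge0; rewrite ler1n.
move=> d0; case: P => [_|x y]; first by rewrite /= mulr0 subr0 normr0.
have [->|y0] := eqVneq y 0.
  move=> /height_x_on_curve0 ->; rewrite addp_double0.
  by rewrite /= mulr0 subr0 normr0.
move=> /(addp_double d0)/(_ y0)[nz [y' ->]]; rewrite !height_x_Affine.
have [l1 l2] := rat_height_duplication nz.
move: l1 l2 (rat_height_gt0 x) (rat_height_gt0 ((x ^+ 2 + 1) ^+ 2 / (4 * (x ^+ 3 - x)))).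
move: (rat_height _) (rat_height _) => m n l1 l2 n0 m0.
have n0R : 0 < n%:R :> R by rewrite ltr0n.
have m0R : 0 < m%:R :> R by rewrite ltr0n.
have {}l1 : 4 * ln n%:R <= ln 16 + ln m%:R :> R.
  rewrite mulr_natl -lnXn // -lnM ?posrE // ler_ln ?posrE ?mulr_gt0 ?exprn_gt0 //.
  by rewrite -natrX -natrM ler_nat.
have {}l2 : ln m%:R <= ln 16 + 4 * ln n%:R :> R.
  rewrite mulr_natl -lnXn // -lnM ?posrE ?exprn_gt0 // ler_ln ?posrE ?mulr_gt0 ?exprn_gt0 //.
  by rewrite -natrX -natrM ler_nat (leq_trans l2) // leq_mul2r orbT.
by rewrite ler_norml; apply/andP; split; lra.
Qed.

(** Tate's telescoping argument: a corrected sequence [b] is nondecreasing and bounded, so the limit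
    exists and is at least [b 0]. *)
Lemma canonical_height_ge d P : (0 < d)%N -> on_curve d P ->
  2^-1 * height_x R P - ln 16 <= canonical_height R d P.
Proof.
move=> d0 cP; pose L : R := ln 16.
have L0 : 0 <= L by apply: ln_ge0; rewrite ler1n.
pose Q n := iter n (fun Q => addp d Q Q) P.
have cQ n : on_curve d (Q n) by elim: n => //= n IH; apply: on_curve_addp.
pose a n : R := 4 ^- n * (2^-1 * height_x R (Q n)).
have q0 n : 0 < 4 ^- n :> R by rewrite invr_gt0 exprn_gt0.
have step n : `|a n.+1 - a n| <= 4 ^- n * (L / 8).
  have -> : a n.+1 - a n = 4 ^- n * (8^-1 * (height_x R (Q n.+1) - 4 * height_x R (Q n))).
    rewrite /a exprS invfM; move: (4 ^- n) => t.
    by field.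
  rewrite normrM (gtr0_norm (q0 n)) ler_pM2l // normrM ger0_norm ?invr_ge0 //.
  by rewrite mulrC ler_pM2r ?invr_gt0 //; exact: height_x_double.
have qS n : 4 ^- n.+1 = 4 ^- n / 4 :> R by rewrite exprS invfM mulrC.
(* The correction absorbs each step, since [L - L / 4 >= L / 8]. *)
pose b n : R := a n - L * 4 ^- n.
have incr : {homo b : m n / (m <= n)%N >-> m <= n}.
  apply/nondecreasing_seqP => n; rewrite /b qS.
  have := step n; rewrite ler_norml => /andP[+ _].
  move: (4 ^- n) (q0 n) => t t0 h; nra.
have decr n : a n + L * 4 ^- n <= a 0%N + L.
  elim: n => [|n IH]; first by rewrite expr0 invr1 mulr1.
  apply: le_trans IH; rewrite qS.
  have := step n; rewrite ler_norml => /andP[_].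
  move: (4 ^- n) (q0 n) => t t0 h; nra.
have bub : has_ubound (range b).
  exists (a 0%N + L) => _ [n _ <-]; apply: le_trans (decr n).
  rewrite /b; have := mulr_ge0 L0 (ltW (q0 n)); lra.
have cb : cvgn b := nondecreasing_is_cvgn incr bub.
have cq : (fun n => L * 4 ^- n : R) @ \oo --> (L * 0 : R).
  apply: cvgM; first exact: cvg_cst.
  under eq_fun do rewrite -exprVn.
  by apply: cvg_expr; rewrite ger0_norm ?invr_ge0 // invf_lt1 // ltr1n.
have aE : a = b \+ (fun n => L * 4 ^- n).
  by apply/funext => n; rewrite /b /= subrK.
have ca : cvgn a.
  by rewrite aE; apply: is_cvgD => //; apply/cvg_ex; exists (L * 0).
rewrite /canonical_height -/a; apply: limr_ge => //.
near=> n; apply: (@le_trans _ _ (b n)).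
  apply: le_trans (incr 0%N n (leq0n n)).
  by rewrite /b /a /= expr0 invr1 mul1r mulr1.
rewrite /b; have := mulr_ge0 L0 (ltW (q0 n)); lra.
Unshelve. all: by end_near.
Qed.

End Heights.

(** * Northcott finiteness and the minimum behind [eta] *)

Lemma finite_rat_height N : finite_set [set x : rat | (rat_height x <= N)%N].
Proof.
pose f (k : nat * nat) : rat := k.1%:R / k.2%:R.
pose s := [seq f (i, j) | i <- iota 0 N.+1, j <- iota 0 N.+1].
apply: (@sub_finite_set _ _ [set` s ++ map -%R s]); last exact: finite_seq.
move=> x /= hx.
have ms : f (`|numq x|%N, `|denq x|%N) \in s.
  apply/allpairsP; exists (`|numq x|%N, `|denq x|%N); rewrite !mem_iota /= !add0n !ltnS.
  by split=> //; apply: leq_trans hx; rewrite ?leq_maxl ?leq_maxr.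
have dE : (`|denq x|%N)%:R = (denq x)%:~R :> rat.
  by rewrite pmulrn abszE gtr0_norm // denq_gt0.
suff : x \in s ++ map -%R s by [].
rewrite mem_cat; apply/orP.
have [n0|n0] := leP 0 (numq x); [left|right].
  by move: ms; rewrite /f /= dE pmulrn abszE ger0_norm // divq_num_den.
apply/mapP; exists (f (`|numq x|%N, `|denq x|%N)) => //.
rewrite /f /= dE -mulNr pmulrn abszE ltr0_norm //.
by rewrite mulrNz opprK divq_num_den.
Qed.

Lemma finite_points d N : (0 < d)%N ->
  finite_set [set P | on_curve d P /\
    exists x y, P = Affine x y /\ (rat_height x <= N)%N].
Proof.
move=> d0; have dN0 : (d%:R : rat) != 0 by rewrite pnatr_eq0 -lt0n.
apply: (@sub_finite_set _ _ (\bigcup_(x in [set x : rat | (rat_height x <= N)%N])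
   (Affine x @` [set y | d%:R * y ^+ 2 = x ^+ 3 - x]))).
  by move=> P [cP [x [y [PE hx]]]]; exists x => //; exists y; rewrite ?PE // PE in cP *.
apply: bigcup_finite; first exact: finite_rat_height.
move=> x _; apply: finite_image.
have [->|/set0P[y0 /= e0]] := eqVneq [set y | d%:R * y ^+ 2 = x ^+ 3 - x] set0.
  exact: finite_set0.
apply: (@sub_finite_set _ _ [set` [:: y0; - y0]]); last exact: finite_seq.
move=> y /= e; rewrite !inE -eqf_sqr; apply/eqP; apply: (mulfI dN0).
by rewrite e e0.
Qed.

Lemma finite_set_has_min (R : realType) (A : set R) : finite_set A -> A !=set0 ->
  exists2 m, A m & lbound A m.
Proof.
move=> /finite_seqP[s ->]; elim: s => [|x s IH] [y]; first by [].
move=> _; case: s IH => [_|z s IH].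
  by exists x; rewrite /= ?inE // => w /=; rewrite inE => /eqP ->.
have [|m ms ml] := IH; first by exists z; rewrite /= mem_head.
have [xm|mx] := leP x m.
  exists x; first by rewrite /= mem_head.
  move=> w /=; rewrite inE => /orP[/eqP ->//|ws].
  exact: le_trans xm (ml _ ws).
exists m; first by rewrite /= inE; apply/orP; right.
by move=> w /=; rewrite inE => /orP[/eqP ->|ws]; [exact: ltW|exact: ml].
Qed.

Lemma nontorsion_Affine d P : nontorsion_points d P ->
  exists x y, P = Affine x y /\ y != 0.
Proof.
case: P => [|x y] [cP nt]; first by case: nt; exists 1%N.
exists x, y; split=> //; apply/eqP => y0; apply: nt; exists 2%N => //.
by rewrite /mulp y0 /= eqxx oppr0 eqxx.
Qed.

Section Eta.
Variable R : realType.

Lemma canonical_height_has_min d : (0 < d)%N -> nontorsion_points d !=set0 ->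
  exists m : R, ((canonical_height R d @` nontorsion_points d)
    `&` lbound (canonical_height R d @` nontorsion_points d)) m.
Proof.
move=> d0 [P0 nP0]; set ch := canonical_height R d.
pose F := [set P | nontorsion_points d P /\ ch P <= ch P0].
(* By [canonical_height_ge], a point with [ch P <= ch P0] has abscissa of height at most this bound,
   so [F] is finite. *)
pose N := Num.truncn (expR (2 * (ch P0 + ln 16)) : R).
have finF : finite_set F.
  apply: (sub_finite_set _ (finite_points N d0)) => P [nP hP].
  have [cP _] := nP; split=> //.
  have [x [y [PE _]]] := nontorsion_Affine nP; exists x, y; split=> //.
  rewrite /N truncn_ge_nat ?expR_ge0 //.
  have := canonical_height_ge R d0 cP; rewrite -/ch => h.
  have hn : 0 < (rat_height x)%:R :> R by rewrite ltr0n rat_height_gt0.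
  rewrite -[leLHS]lnK ?posrE // ler_expR -(height_x_Affine R x y) -PE; lra.
have [||m [P [nP lP] <-] lb] := @finite_set_has_min R (ch @` F).
- exact: finite_image.
- by exists (ch P0); exists P0.
exists (ch P); split; first by exists P.
move=> _ [Q nQ <-]; have [h|h] := leP (ch Q) (ch P0); last exact: le_trans lP (ltW h).
by apply: lb; exists Q.
Qed.

(** The minimum is attained, so [set_min] does not fall back on its default 0. *)
Lemma eta_le_ex d (v : R) : (0 < d)%N -> (eta R d <= v%:E)%E ->
  exists P, nontorsion_points d P /\ expR (canonical_height R d P) <= v.
Proof.
move=> d0; rewrite /eta; case: asboolP => // ne; rewrite lee_fin.
have := xgetPex 0 (canonical_height_has_min d0 ne).
by rewrite -/(set_min _) => -[[P nP <-] _] h; exists P.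
Qed.

End Eta.

(** Clearing denominators with [x = p / q] shows that [d] and [p q (p^2 - q^2)] agree modulo
    squares. Positivity forces [x > 1] or [-1 < x < 0], giving [(a, b) = (p, q)] or [(q, - p)]. *)
Lemma quartic_of_point d x y : (0 < d)%N -> squarefree d ->
  on_curve d (Affine x y) -> y != 0 ->
  exists a b, [/\ (0 < b < a)%N, (a <= rat_height x)%N, coprime a b
    & d = sqfree_part (quartic (a, b))].
Proof.
move=> d0 sd cP y0; move: cP => /= e.
pose p := numq x; pose q := denq x; pose r := numq y; pose s := denq y.
have q0 : 0 < q by apply: denq_gt0.
have s0 : 0 < s by apply: denq_gt0.
have r0 : r != 0 by rewrite numq_eq0.
have qR : (q%:~R : rat) != 0 by rewrite intr_eq0 gt_eqF.
have sR : (s%:~R : rat) != 0 by rewrite intr_eq0 gt_eqF.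
have eZ : d%:Z * (r * q ^+ 2) ^+ 2 = p * q * (p ^+ 2 - q ^+ 2) * s ^+ 2.
  apply: (@intr_inj rat).
  rewrite !(rmorphXn, rmorphM, rmorphB) /= -pmulrn.
  have -> : p%:~R = x * q%:~R by rewrite -[x]divq_num_den divfK.
  have -> : r%:~R = y * s%:~R by rewrite -[y]divq_num_den divfK.
  transitivity (d%:R * y ^+ 2 * (s%:~R ^+ 2 * q%:~R ^+ 4)); first by ring.
  by rewrite e; ring.
have cop : coprime `|p| `|q| := coprime_num_den x.
have fin a b : (0 < b < a)%N -> (a <= rat_height x)%N -> coprime a b ->
    (quartic (a, b))%:Z = p * q * (p ^+ 2 - q ^+ 2) ->
    exists a b, [/\ (0 < b < a)%N, (a <= rat_height x)%N, coprime a b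
    & d = sqfree_part (quartic (a, b))].
  move=> ba ah cab qE; exists a, b; split=> //; apply/esym.
  have Q0 : (0 < quartic (a, b))%N by rewrite /quartic /= !muln_gt0; lia.
  move: (quartic (a, b)) Q0 qE => Q Q0 qE.
  apply: (@sqfree_part_eq _ (absz (r * q ^+ 2)) _ (absz s)) => //.
  - by rewrite absz_gt0 mulf_neq0 // expf_neq0 // gt_eqF.
  - by rewrite absz_gt0 gt_eqF.
  apply/eqP; rewrite -eqz_nat !PoszM !abszE -!expr2.
  by rewrite !real_normK ?num_real // eZ qE.
have pos : 0 < p * q * (p ^+ 2 - q ^+ 2).
  rewrite -(pmulr_lgt0 _ (_ : 0 < s ^+ 2)) ?exprn_gt0 // -eZ mulr_gt0 //.
  by rewrite exprn_even_gt0 // mulf_neq0 // expf_neq0 // gt_eqF.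
have pqE : p * q * (p ^+ 2 - q ^+ 2) = q * (p * (p - q) * (p + q)) by ring.
have la : (`|p| <= rat_height x)%N by apply: leq_maxl.
have lb : (`|q| <= rat_height x)%N by apply: leq_maxr.
rewrite pqE pmulr_rgt0 // in pos.
have [p0|p0] := leP 0 p.
  have pq : q < p.
    rewrite ltNge; apply: contraTN pos => h; rewrite -leNgt mulrAC.
    by rewrite mulr_ge0_le0 // ?subr_le0 // mulr_ge0 // addr_ge0 // ltW.
  apply: (fin `|p|%N `|q|%N) => //; first lia.
  rewrite /quartic /= !PoszM PoszD -subzn; last lia.
  by rewrite !abszE !ger0_norm ?(ltW q0) //; ring.
have pq : - p < q.
  rewrite -subr_gt0 opprK addrC ltNge; apply: contraTN pos => h; rewrite -leNgt.
  by rewrite mulr_ge0_le0 // mulr_le0 ?(ltW p0) // subr_le0 (le_trans (ltW p0)) ?ltW.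
apply: (fin `|q|%N `|p|%N) => //; first lia; first by rewrite coprime_sym.
rewrite /quartic /= !PoszM PoszD -subzn; last lia.
by rewrite !abszE (ltr0_norm p0) (gtr0_norm q0); ring.
Qed.

(** * The density estimate *)

Section Asymptotics.
Variable R : realType.

Lemma powR_ge1 (X r : R) : 1 <= X -> 0 <= r -> 1 <= X `^ r.
Proof. by move=> X1 r0; rewrite -(powRr0 X) ler_powR. Qed.

Lemma ln_le_powR (X delta : R) : 1 <= X -> 0 < delta -> ln X <= delta^-1 * X `^ delta.
Proof.
move=> X1 d0; rewrite ler_pdivlMl // -ln_powR.
by apply/ltW/ln_sublinear/powR_gt0; apply: lt_le_trans X1.
Qed.

Lemma cvg_powR_bound (f : R -> R) (K gamma : R) : 0 < gamma ->
  (forall X, 1 <= X -> 0 <= f X <= K * X `^ (- gamma)) ->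
  f @ +oo --> (0 : R).
Proof.
move=> g0 hf; apply/cvgrPdist_lt => e e0.
pose B : R := `|K| + 1; have B0 : 0 < B by rewrite ltr_wpDl.
near=> X.
have X1 : 1 <= X by near: X; exact: nbhs_pinfty_ge.
have X0 : 0 < X by apply: lt_le_trans X1.
have XB : (B / e) `^ gamma^-1 < X by near: X; exact: nbhs_pinfty_gt.
have /andP[f0 fK] := hf X X1.
rewrite sub0r normrN ger0_norm //; apply: le_lt_trans fK _.
rewrite powRN ltr_pdivrMr ?powR_gt0 //.
have : B / e < X `^ gamma.
  have -> : B / e = ((B / e) `^ gamma^-1) `^ gamma.
    by rewrite -powRrM mulVf ?gt_eqF // powRr1 // divr_ge0 // ltW.
  by apply: gt0_ltr_powR => //; rewrite nnegrE ?powR_ge0 // ltW.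
rewrite ltr_pdivrMr // mulrC; apply: le_lt_trans.
by rewrite /B (le_trans (ler_norm K)) // lerDl.
Unshelve. all: by end_near.
Qed.

Lemma harmonic_sum_le_powR (X delta : R) (y : nat) : 1 <= X -> 0 < delta ->
  (0 < y)%N -> y%:R <= 2 * X -> harmonic_sum R y <= (3 + delta^-1) * X `^ delta.
Proof.
move=> X1 d0 y0 yX; apply: le_trans (harmonic_sum_le_ln R y0) _.
have X0 : 0 < X by apply: lt_le_trans X1.
have : ln y%:R <= ln 2 + ln X :> R.
  by rewrite -lnM ?posrE // ler_ln ?posrE ?ltr0n // mulr_gt0.
have : ln 2 < 2 :> R by apply: ln_sublinear.
have := ln_le_powR X1 d0; have := powR_ge1 X1 (ltW d0).
move: (ln X) (ln _) (ln _) (X `^ delta) (delta^-1) => *; lra.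
Qed.

End Asymptotics.

(** The constant is [16^2]: the loss [ln 16] in the height is doubled when passing from [h_x / 2] to
    [h_x]. *)
Lemma quartic_of_eta_le (R : realType) (d : nat) (v : R) :
  (0 < d)%N -> squarefree d -> (eta R d <= v%:E)%E ->
  exists a b, [/\ (0 < b < a)%N, a%:R <= 256 * v ^+ 2, coprime a b
    & d = sqfree_part (quartic (a, b))].
Proof.
move=> d0 sd /(eta_le_ex d0)[P [nP hP]].
have [x [y [PE y0]]] := nontorsion_Affine nP; have [cP _] := nP.
have := canonical_height_ge R d0 cP; rewrite PE in cP *.
have [a [b [ba ah cab dE]]] := quartic_of_point d0 sd cP y0.
rewrite height_x_Affine -PE => h; exists a, b; split=> //.
have hn : 0 < (rat_height x)%:R :> R by rewrite ltr0n rat_height_gt0.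
apply: (@le_trans _ _ (rat_height x)%:R); first by rewrite ler_nat.
have -> : 256 = 16 ^+ 2 :> R by ring.
rewrite -exprMn; apply: (@le_trans _ _ ((16 * expR (canonical_height R d P)) ^+ 2)); last first.
  by rewrite lerXn2r ?nnegrE ?mulr_ge0 ?expR_ge0 // ?ler_pM2l // (le_trans (expR_ge0 _) hP).
rewrite -{1}(lnK (_ : 16 \is Num.pos)) ?posrE // -expRD -expRM_natl -[leLHS]lnK ?posrE //.
by rewrite ler_expR; lra.
Qed.

Lemma card_small_eta (R : realType) (e eps X : R) :
  0 < e <= 1 / 4 -> e <= eps -> 1 <= X ->
  #|` fset_set [set d : nat | [/\ (1 <= d)%N, d%:R <= X, squarefree d
     & (eta R d <= (d%:R `^ (5 / 8 - eps))%:E)%E]] |%:R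
  <= 1056 * (3 + (e / 12)^-1) ^+ 6 * X `^ (1 - e / 2).
Proof.
move=> /andP[e0 e4] ee X1; set S := [set d | _].
have X0 : 0 < X by apply: lt_le_trans X1.
have XE r s : X `^ (r + s) = X `^ r * X `^ s by rewrite powRD // (gt_eqF X0) implybT.
(* [m] bounds [a], and [y] bounds twice a product of three squarefree parts, itself at most
   [X^(3/4)]. *)
pose v := X `^ (5 / 8 - e); pose m := Num.truncn (256 * v ^+ 2).
pose y := Num.truncn (2 * X `^ (3 / 4)).
have finS : finite_set S.
  apply: (@sub_finite_set _ _ `I_(Num.truncn X).+1); last exact: finite_II.
  by move=> d [_ dX _ _] /=; rewrite ltnS truncn_ge_nat ?(ltW X0).
have vE : v ^+ 2 = X `^ (5 / 4 - 2 * e).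
  by rewrite expr2 -XE; congr (_ `^ _); lra.
have m0 : 0 <= 256 * v ^+ 2 by rewrite mulr_ge0 // exprn_ge0 // powR_ge0.
have y0 : 0 <= 2 * X `^ (3 / 4) by rewrite mulr_ge0 // powR_ge0.
have card1 : (#|` fset_set S| <= 8 * #|conic_pairs (2 * m) y|)%N.
  apply: card_quartic_le => d; rewrite in_fset_set // inE => -[d0 dX sd hd].
  have [|a [b [ba ah cab dE]]] := @quartic_of_eta_le R d v d0 sd.
    apply: le_trans hd _; rewrite lee_fin.
    apply: (@le_trans _ _ (d%:R `^ (5 / 8 - e))).
      by rewrite ler_powR ?ler1n //; lra.
    by rewrite ge0_ler_powR ?nnegrE ?(ltW X0) //; lra.
  exists a, b; split=> //; first by rewrite truncn_ge_nat.
  move=> P hP; rewrite truncn_ge_nat // natrM ler_pM2l //.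
  rewrite -(@ler_pXn2r _ 4) ?nnegrE ?powR_ge0 //.
  rewrite -(powR_mulrn 4 (powR_ge0 _ _)) -powRrM.
  have -> : 3 / 4 * 4%:R = 3%:R :> R by lra.
  rewrite powR_mulrn ?(ltW X0) //.
  apply: (@le_trans _ _ (d%:R ^+ 3)); first by rewrite -!natrX ler_nat.
  by rewrite lerXn2r ?nnegrE ?(ltW X0).
have y1 : (0 < y)%N.
  by rewrite truncn_ge_nat //; have := @powR_ge1 R X (3 / 4) X1; lra.
have yle : y%:R <= 2 * X `^ (3 / 4) by have /andP[] := truncn_itv y0.
have mle : m%:R <= 256 * v ^+ 2 by have /andP[] := truncn_itv m0.
(* The sixth power of [X^delta] costs [X^(e/2)], half of the saving [X^(-e)]. *)
pose delta := e / 12; have delta0 : 0 < delta by rewrite divr_gt0.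
have hH : harmonic_sum R y <= (3 + delta^-1) * X `^ delta.
  apply: harmonic_sum_le_powR => //; apply: le_trans yle _.
  by rewrite ler_pM2l // ler1_powR //; lra.
have hy : y%:R <= 2 * X `^ (1 - e).
  by apply: le_trans yle _; rewrite ler_pM2l // ler_powR //; lra.
(* The constants multiply to [2 * 256 * 2 = 32^2], and the exponents [5/4 - 2 e] and [3/4] add up to
   [2 (1 - e)]. *)
have hs : Num.sqrt ((2 * m)%:R * y%:R) <= 32 * X `^ (1 - e).
  have p0 : 0 <= 32 * X `^ (1 - e) by rewrite mulr_ge0 // powR_ge0.
  rewrite -[leRHS](ger0_norm p0) -sqrtr_sqr ler_wsqrtr //.
  have -> : (32 * X `^ (1 - e)) ^+ 2 = (2 * (256 * v ^+ 2)) * (2 * X `^ (3 / 4)).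
    rewrite vE exprMn [X in _ * X = _]expr2 -XE.
    have -> : 1 - e + (1 - e) = (5 / 4 - 2 * e) + 3 / 4 by lra.
    by rewrite XE; ring.
  by rewrite natrM ler_pM // ?mulr_ge0 // ler_pM2l.
rewrite -(ler_nat R) in card1; apply: le_trans card1 _.
(* Here [66 = 2 + 2 * 32], and [1056 = 8 * 2 * 66]. *)
rewrite natrM; apply: (@le_trans _ _ (8 * (2 * (66 * X `^ (1 - e)) *
    ((3 + delta^-1) * X `^ delta) ^+ 6))).
  rewrite ler_pM2l //; apply: le_trans (card_conic_pairs R (2 * m) y) _.
  apply: ler_pM.
  - by rewrite mulr_ge0 ?addr_ge0 // mulr_ge0 ?sqrtr_ge0.
  - by rewrite exprn_ge0 // harmonic_sum_ge0.
  - by rewrite ler_pM2l //; lra.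
  by rewrite lerXn2r ?nnegrE ?harmonic_sum_ge0 // (le_trans (harmonic_sum_ge0 _ _) hH).
rewrite exprMn -(powR_mulrn 6 (powR_ge0 _ _)) -powRrM.
have -> : delta * 6%:R = e / 2 by rewrite /delta; lra.
have -> : 1 - e / 2 = (1 - e) + e / 2 by lra.
rewrite (XE (1 - e)) le_eqVlt -[e / 12]/delta; apply/orP; left; apply/eqP.
by move: (X `^ (1 - e)) (X `^ (e / 2)) ((3 + delta^-1) ^+ 6) => x z w; ring.
Qed.

Theorem theorem2 (R : realType) (eps : R) (heps : 0 < eps) :
  (fun X : R =>
     #|` fset_set [set d : nat |
           [/\ (1 <= d)%N, d%:R <= X, squarefree d
             & (eta R d <= (d%:R `^ (5 / 8 - eps))%:E)%E]] |%:R / X)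
    @ +oo --> (0 : R).
Proof.
(* Lowering [eps] only enlarges the counted set, as [d >= 1]; [e <= 1/4] gives
   [X^(3/4) <= X^(1 - e)]. *)
pose e := Num.min eps (1 / 4).
have e0 : 0 < e by rewrite lt_min heps /=; lra.
have e4 : e <= 1 / 4 by rewrite ge_min lexx orbT.
have ee : e <= eps by rewrite ge_min lexx.
apply: (@cvg_powR_bound R _ (1056 * (3 + (e / 12)^-1) ^+ 6) (e / 2)).
  by rewrite divr_gt0.
move=> X X1; have X0 : 0 < X by apply: lt_le_trans X1.
rewrite divr_ge0 ?(ltW X0) //= ler_pdivrMr // -mulrA.
have -> : X `^ (- (e / 2)) * X = X `^ (1 - e / 2).
  by rewrite powRD ?(gt_eqF X0) ?implybT // powRr1 ?(ltW X0) // mulrC.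
by apply: card_small_eta => //; rewrite e0.
Qed.
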